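(* Let $q$ be a power of a prime $p$, let $0\le j\le q-2$ and $n\ge 1$ be integers, and put $k=2j+2+(n-1)(q-1)$ and $m\equiv j+1\pmod{q-1}$. Let $T$ and $F$ be the $n\times n$ matrices over $\mathbb{C}_\infty$ defined in the context (with respect to the basis described there, $T$ is the matrix of the trace $Tr$ and $t^{m-k}F$ is the matrix of the Fricke involution acting on $S^1_{k,m}(\Gamma_0(t))$), and let $I$ be the $n\times n$ identity matrix. Then $$S^1_{k,m}(\Gamma_0(t))=S^{1,old}_{k,m}(\Gamma_0(t))\oplus S^{1,new}_{k,m}(\Gamma_0(t))\iff I-t^{-k}(TF)^2\ \text{is invertible.}$$
   Context: Modular forms. $K=\mathbb{F}_q(t)$, $K_\infty$ is its completion at $\infty=1/t$, $\mathbb{C}_\infty$ is the completion of an algebraic closure of $K_\infty$, and $\Omega=\mathbb{P}^1(\mathbb{C}_\infty)-\mathbb{P}^1(K_\infty)$ is the Drinfeld upper half plane. For $\gamma=\begin{pmatrix}a&b\\c&d\end{pmatrix}\in GL_2(K_\infty)$ and $\varphi:\Omega\to\mathbb{C}_\infty$ put $(\varphi|_{k,m}\gamma)(z)=\varphi(\gamma z)(\det\gamma)^m(cz+d)^{-k}$. For $\Gamma=GL_2(\mathbb{F}_q[t])$ or $\Gamma=\Gamma_0(t)=\{\begin{pmatrix}a&b\\c&d\end{pmatrix}\in GL_2(\mathbb{F}_q[t]): c\equiv0 \bmod t\}$, $S^1_{k,m}(\Gamma)$ is the (finite dimensional) $\mathbb{C}_\infty$-space of cusp forms of weight $k$ and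 type $m$: rigid analytic $\varphi:\Omega\to\mathbb{C}_\infty$ with $\varphi|_{k,m}\gamma=\varphi$ for all $\gamma\in\Gamma$, holomorphic and vanishing at all cusps. It depends on $m$ only modulo $q-1$. The Atkin operator on $S^1_{k,m}(\Gamma_0(t))$ is $\mathbf{U}_t(\varphi)(z)=\sum_{b\in\mathbb{F}_q}\varphi\left(\frac{z+b}{t}\right)$. Oldforms: let $\delta_1,\delta_t:S^1_{k,m}(GL_2(\mathbb{F}_q[t]))\to S^1_{k,m}(\Gamma_0(t))$ be $\delta_1(\varphi)=\varphi$, $\delta_t(\varphi)(z)=t^m\varphi(tz)$, and $\delta(\varphi,\psi)=\delta_1\varphi+\delta_t\psi$; then $S^{1,old}_{k,m}(\Gamma_0(t))=\mathrm{Im}(\delta)$. Newforms: let $\varphi^{Fr}=\varphi|_{k,m}\begin{pmatrix}0&-1\\t&0\end{pmatrix}$ (Fricke involution), $Tr(\varphi)=\sum_{\gamma\in R}\varphi|_{k,m}\gamma$ with $R=\{\mathrm{Id}\}\cup\{\begin{pmatrix}0&-1\\1&b\end{pmatrix}:b\in\mathbb{F}_q\}$, and $Tr'(\varphi)=Tr(\varphi^{Fr})$; then $S^{1,new}_{k,m}(\Gamma_0(t))=\mathrm{Ker}(Tr)\cap\mathrm{Ker}(Tr')$. Basis. Let $\Gamma_1(t)\subset\Gamma_0(t)$ be the subgroup with diagonal entries $\equiv1 \bmod t$. Teitelbaum's residue isomorphism identifies $S^1_{k,m}(\Gamma_1(t))$ with the harmonic cocycles of weight $k$ for $\Gamma_1(t)$: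 functions $\mathbf{c}$ from oriented edges of the Bruhat-Tits tree of $GL_2(K_\infty)$ (edges $=GL_2(K_\infty)/Z(K_\infty)\mathcal{I}(K_\infty)$, with $\mathcal{I}$ the Iwahori subgroup) to the dual of $V=\bigoplus_{i=0}^{k-2}\mathbb{C}_\infty X^iY^{k-2-i}$ which are harmonic, antisymmetric under edge reversal, and $\Gamma_1(t)$-equivariant for the action $(\gamma\omega)(X^iY^{k-2-i})=\det(\gamma)^{1-m}\omega((aX+bY)^i(cX+dY)^{k-2-i})$. Such a cocycle is determined by its value on the edge $\bar e$ represented by $\begin{pmatrix}0&1\\1&0\end{pmatrix}$, and a basis is $\mathbf{c}_0,\dots,\mathbf{c}_{k-2}$ where $\mathbf{c}_i(\bar e)(X^lY^{k-2-l})=1$ if $l=i$ and $0$ otherwise. For $k,j,n,m$ as in the claim, $S^1_{k,m}(\Gamma_0(t))$ has basis $\mathbf{c}_{j+(b-1)(q-1)}$, $1\le b\le n$. Matrices (size $n\times n$). $M=(m_{a,b})$ has entries in $\mathbb{F}_p$: $$m_{a,b}=-\left[\binom{j+(n-a)(q-1)}{j+(n-b)(q-1)}+(-1)^{j+1}\binom{j+(n-a)(q-1)}{j+(b-1)(q-1)}\right]\ (a\ne b),\qquad m_{a,a}=(-1)^j\binom{j+(n-a)(q-1)}{j+(a-1)(q-1)},$$ with $\binom{x}{y}=0$ if $y>x$. With $s_i=j+1+(i-1)(q-1)$: $D=\mathrm{diag}(t^{s_1},\dots,t^{s_n})$; $F$ is the antidiagonal matrix whose entry in row $n+1-b$, column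 $b$ is $(-t)^{s_b}$; $A$ is the antidiagonal matrix with all antidiagonal entries $(-1)^{j+1}$; $T=I+MA$. In the basis $\mathbf{c}_{j+(b-1)(q-1)}$, $1\le b\le n$, of $S^1_{k,m}(\Gamma_0(t))$ (column convention), $\mathbf{U}_t$ has matrix $MD$, the Fricke involution has matrix $t^{m-k}F$, $Tr$ has matrix $T$, and $Tr'$ has matrix $t^{m-k}(F+MD)=t^{m-k}TF$. *)

(* Defs.v *)
From HB Require Import structures.
From mathcomp Require Import all_boot all_order all_algebra.
From mathcomp Require Import all_classical all_reals topology normedtype.
Set Implicit Arguments.
Unset Strict Implicit.
Unset Printing Implicit Defensive.
Import Order.TTheory GRing.Theory Num.Theory.
Import numFieldNormedType.Exports.
Local Open Scope classical_set_scope.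
Local Open Scope ring_scope.

Notation ratfun Fq := {fraction {poly Fq}}.

Section ValuedField.
Variables (R : realType) (C : fieldType) (abs : C -> R).

Definition cvg_abs (u : nat -> C) (l : C) : Prop :=
  abs (u n - l) @[n --> \oo] --> (0 : R).

Definition cauchy_abs (u : nat -> C) : Prop :=
  forall eps : R, 0 < eps ->
  exists N, forall i j, (N <= i)%N -> (N <= j)%N -> abs (u i - u j) < eps.

Definition closure_abs (A : set C) : set C :=
  [set x | forall eps : R, 0 < eps -> exists2 a, A a & abs (x - a) < eps].

Definition algebraic_over (A : set C) : set C :=
  [set x | exists p : {poly C}, [/\ p != 0, forall i, A p`_i & root p x]].

End ValuedField.

(* C_oo is given by the properties that determine it up to isometric
   isomorphism over K = F_q(t): an algebraically closed field, complete for a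
   non-archimedean absolute value extending |f| = q ^ deg f, in which the
   elements algebraic over K_oo are dense. As the field is complete, the
   completion K_oo of K is the closure of K in it. *)
Record Cinf (R : realType) (Fq : finFieldType) := MkCinf {
  Cinf_sort :> closedFieldType;
  inK : {rmorphism ratfun Fq -> Cinf_sort};
  abs : Cinf_sort -> R;
  abs_ge0 : forall x, 0 <= abs x;
  abs_eq0 : forall x, abs x = 0 <-> x = 0;
  absM : forall x y, abs (x * y) = abs x * abs y;
  abs_ultra : forall x y, abs (x + y) <= Num.max (abs x) (abs y);
  abs_deg : forall f : {poly Fq}, f != 0 ->
    abs (inK (FracField.tofrac f)) = #|Fq|%:R ^+ (size f).-1;
  abs_complete : forall u, cauchy_abs abs u -> exists l, cvg_abs abs u l;
  abs_dense : forall x,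
    closure_abs abs (algebraic_over (closure_abs abs (range inK))) x
}.

Section DrinfeldForms.
Variables (R : realType) (Fq : finFieldType) (C : Cinf R Fq).

Definition inA (f : {poly Fq}) : C := inK C (FracField.tofrac f).

Definition tC : C := inA 'X.

Definition Kinf : set C := closure_abs (@abs R Fq C) (range (inK C)).

(* P^1(C_oo) - P^1(K_oo), in the affine coordinate z. *)
Definition Omega := {z : C | z \notin Kinf}.

Definition OmegaFun := Omega -> C^o.

(* |z|_i >= r, where |z|_i is the infimum of |z - x| over x in K_oo. *)
Definition imag_ge (r : R) (z : Omega) : Prop :=
  forall x, Kinf x -> r <= abs (val z - x).

(* The affinoids of the standard admissible covering of Omega. *)
Definition affinoid (N : nat) : set Omega :=
  [set z | abs (val z) <= #|Fq|%:R ^+ N /\ imag_ge (#|Fq|%:R ^- N) z].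

Definition rigid_analytic (f : OmegaFun) : Prop :=
  forall (N : nat) (eps : R), 0 < eps ->
  exists P Q : {poly C}, forall z, affinoid N z ->
    Q.[val z] != 0 /\ abs (f z - P.[val z] / Q.[val z]) < eps.

Definition mx2 (T : Type) (a b c d : T) : 'M[T]_2 :=
  \matrix_(i, j) if i == 0 then if j == 0 then a else b
                 else if j == 0 then c else d.

(* For g in GL_2(K_oo) the fraction lies in Omega, so that the default value of
   insubd is not used. *)
Definition mobius (g : 'M[C]_2) (z : Omega) : Omega :=
  insubd z ((g 0 0 * val z + g 0 1) / (g 1 0 * val z + g 1 1)).

Definition slash (k : nat) (m : int) (f : OmegaFun) (g : 'M[C]_2) : OmegaFun :=
  fun z => f (mobius g z) * (\det g) ^ m * (g 1 0 * val z + g 1 1) ^- k.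

(* The exponential function of the lattice L = c F_q[t]; the product over the
   nonzero elements of L is the limit of the finite products over deg a < d. *)
Definition lattice_prod (c : ratfun Fq) (z : C) (d : nat) : C :=
  z * \prod_(a : 'rV[Fq]_d | a != 0) (1 - z / (inK C c * inA (rVpoly a))).

Definition lattice_exp (c : ratfun Fq) (z : C) : C :=
  xget 0 [set w | cvg_abs (@abs R Fq C) (lattice_prod c z) w].

(* f is holomorphic and vanishes at infinity: for |z|_i large it is the sum of
   a power series without constant term in the local parameter
   u = 1 / e_L(z) attached to a lattice L = c F_q[t] of translations (the
   condition does not depend on the choice of such a lattice). *)
Definition vanishes_at_infty (f : OmegaFun) : Prop :=
  exists c : ratfun Fq, c != 0 /\
  exists (a : nat -> C) (r : R), a 0%N = 0 /\
  forall z, imag_ge r z ->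
    cvg_abs (@abs R Fq C)
      (fun N => \sum_(i < N) a i * (lattice_exp c (val z)) ^- i) (f z).

Definition GL2A : set 'M[{poly Fq}]_2 := [set g | g \in unitmx].

Definition Gamma0t : set 'M[{poly Fq}]_2 :=
  [set g | g \in unitmx /\ 'X %| g 1 0].

(* The cusps are the points g oo, g in GL_2(K). *)
Definition cusp_forms (k : nat) (m : int) (G : set 'M[{poly Fq}]_2) :
    set OmegaFun :=
  [set f | [/\ rigid_analytic f,
     forall g, G g -> slash k m f (map_mx inA g) = f &
     forall g : 'M[ratfun Fq]_2, g \in unitmx ->
       vanishes_at_infty (slash k m f (map_mx (inK C) g))]].

Definition delta_1 (f : OmegaFun) : OmegaFun := f.

Definition delta_t (m : int) (f : OmegaFun) : OmegaFun :=
  fun z => tC ^ m * f (insubd z (tC * val z)).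

Definition oldforms (k : nat) (m : int) : set OmegaFun :=
  [set delta_1 f + delta_t m g |
     f in cusp_forms k m GL2A & g in cusp_forms k m GL2A].

Definition fricke (k : nat) (m : int) (f : OmegaFun) : OmegaFun :=
  slash k m f (mx2 0 (-1) tC 0).

Definition trace (k : nat) (m : int) (f : OmegaFun) : OmegaFun :=
  slash k m f 1%:M + \sum_(b : Fq) slash k m f (mx2 0 (-1) 1 (inA b%:P)).

Definition trace' (k : nat) (m : int) (f : OmegaFun) : OmegaFun :=
  trace k m (fricke k m f).

Definition newforms (k : nat) (m : int) : set OmegaFun :=
  [set f | [/\ cusp_forms k m Gamma0t f, trace k m f = 0 & trace' k m f = 0]].

Definition is_basis (n : nat) (S : set OmegaFun) (e : 'I_n -> OmegaFun) : Prop :=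
  (forall i, S (e i)) /\
  (forall f, S f -> exists! x : 'cV[C]_n, f = \sum_i x i 0 *: e i).

(* Column convention: the b-th column of P holds the coordinates of L (e b). *)
Definition is_matrix_of (n : nat) (e : 'I_n -> OmegaFun)
    (L : OmegaFun -> OmegaFun) (P : 'M[C]_n) : Prop :=
  forall b, L (e b) = \sum_a P a b *: e a.

Definition direct_sum (S S1 S2 : set OmegaFun) : Prop :=
  S = [set f + g | f in S1 & g in S2] /\ S1 `&` S2 = [set 0].

End DrinfeldForms.

Section Matrices.
Variables (R : realType) (Fq : finFieldType) (C : Cinf R Fq).
Variables (n j : nat).
Local Notation q := #|Fq|.

(* The entry formulas use 1 <= a, b <= n; ordinals are shifted accordingly. *)
Definition M_entry (a b : nat) : C :=
  if a == b then
    (-1) ^+ j * 'C(j + (n - a) * q.-1, j + a.-1 * q.-1)%:R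
  else
    - ('C(j + (n - a) * q.-1, j + (n - b) * q.-1)%:R
       + (-1) ^+ j.+1 * 'C(j + (n - a) * q.-1, j + b.-1 * q.-1)%:R).

Definition s_exp (i : nat) : nat := j.+1 + i.-1 * q.-1.

Definition M_mx : 'M[C]_n := \matrix_(a, b) M_entry a.+1 b.+1.

Definition F_mx : 'M[C]_n :=
  \matrix_(a, b) if (a.+1 == n.+1 - b.+1)%N then (- tC C) ^+ s_exp b.+1 else 0.

Definition A_mx : 'M[C]_n :=
  \matrix_(a, b) if (a.+1 == n.+1 - b.+1)%N then (-1) ^+ j.+1 else 0.

Definition T_mx : 'M[C]_n := 1%:M + M_mx *m A_mx.

End Matrices.

(* Main.v *)
Require Import Defs.
From HB Require Import structures.
From mathcomp Require Import all_boot all_order all_algebra.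
From mathcomp Require Import all_classical all_reals topology normedtype.
From mathcomp Require Import sequences finfield ring lra zify.
Set Implicit Arguments.
Unset Strict Implicit.
Unset Printing Implicit Defensive.
Import Order.TTheory GRing.Theory Num.Theory.
Import numFieldNormedType.Exports.
Local Open Scope classical_set_scope.
Local Open Scope ring_scope.

(* Let T and Phi be the matrices of Tr and of the Fricke involution on
   S(Gamma_0(t)), with Phi^2 = mu. As the trace sums over coset representatives
   of Gamma_0(t) in GL_2(F_q[t]), and there are q + 1 = 1 of them, T is a
   projection onto W = S(GL_2(F_q[t])); moreover delta_t is Phi on W. Hence the
   oldforms are W + Phi W and the newforms are Ker T and Ker T Phi intersected.
   With N = 1 - mu^-1 (T Phi)^2, solving for the old component a + Phi b of a
   vector v leads to N a = T v - mu^-1 T Phi T Phi v, so that N invertible gives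
   the decomposition; conversely N v = 0 makes v - mu^-1 Phi T Phi v both old
   and new, hence 0, and v vanishes because W and Phi W meet trivially. The last
   point follows from T a b = 0 for b <= a and n <= a + b + 1 (indices from 0),
   which kills the coordinates of a vector of W and Phi W from both ends.

   That S(Gamma_0(t)) is a vector space is not obvious for the condition at the
   cusps, since two forms may be expanded along different lattices. It rests on
   e_(cA) = e_(cgA) * prod_b (1 - e_(cgA) / e_(cgA)(cb)) for A = F_q[t] and b
   over the nonzero classes modulo g: then 1 / e_(cA) is a power series in
   1 / e_(cgA), and one composes power series. *)

(** * The absolute value and the field K_oo *)

Section AbsoluteValue.
Variables (R : realType) (Fq : finFieldType) (C : Cinf R Fq).
Implicit Types (x y z : C) (r B eps : R).
Local Notation q := #|Fq|.

Lemma abs0 : abs (0 : C) = 0. Proof. exact/abs_eq0. Qed.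

Lemma abs_neq0 x : (abs x != 0) = (x != 0).
Proof. by congr negb; apply/eqP/eqP => /abs_eq0. Qed.

Lemma abs_gt0 x : (0 < abs x) = (x != 0).
Proof. by rewrite lt_def abs_ge0 andbT abs_neq0. Qed.

Lemma abs1 : abs (1 : C) = 1.
Proof.
have h : abs (1 : C) != 0 by rewrite abs_neq0 oner_eq0.
by apply: (mulfI h); rewrite -absM !mulr1.
Qed.

Lemma absX x n : abs (x ^+ n) = abs x ^+ n.
Proof. by elim: n => [|n IH]; rewrite ?expr0 ?abs1 // !exprS absM IH. Qed.

Lemma absV x : abs x^-1 = (abs x)^-1.
Proof.
have [->|x0] := eqVneq x 0; first by rewrite invr0 abs0 invr0.
have h : abs x != 0 by rewrite abs_neq0.
by apply: (mulfI h); rewrite -absM !mulfV // abs1.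
Qed.

Lemma absN x : abs (- x) = abs x.
Proof.
suff h : abs (-1 : C) = 1 by rewrite -mulN1r absM h mul1r.
apply/eqP; rewrite -(@eqrXn2 _ 2) ?abs_ge0 ?ler01 //.
by rewrite -absX sqrrN !expr1n abs1.
Qed.

Lemma absB x y : abs (x - y) = abs (y - x).
Proof. by rewrite -opprB absN. Qed.

Lemma abs_prod I (s : seq I) (P : pred I) (f : I -> C) :
  abs (\prod_(i <- s | P i) f i) = \prod_(i <- s | P i) abs (f i).
Proof. by apply: (big_morph (@abs R Fq C) (@absM R Fq C)); rewrite abs1. Qed.

Lemma absD_le x y B : abs x <= B -> abs y <= B -> abs (x + y) <= B.
Proof. by move=> hx hy; rewrite (le_trans (abs_ultra _ _))// ge_max hx. Qed.

Lemma absB_le x y B : abs x <= B -> abs y <= B -> abs (x - y) <= B.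
Proof. by move=> hx hy; apply: absD_le; rewrite ?absN. Qed.

Lemma absD_lt x y B : abs x < B -> abs y < B -> abs (x + y) < B.
Proof. by move=> hx hy; rewrite (le_lt_trans (abs_ultra _ _))// gt_max hx. Qed.

Lemma abs_sum_le I (s : seq I) (P : pred I) (f : I -> C) B :
  0 <= B -> (forall i, P i -> abs (f i) <= B) ->
  abs (\sum_(i <- s | P i) f i) <= B.
Proof.
move=> B0 h; apply: (big_ind (fun x => abs x <= B)) => //; first by rewrite abs0.
by move=> x y; apply: absD_le.
Qed.

Lemma abs_eq_of_lt x y : abs (x - y) < abs y -> abs x = abs y.
Proof.
move=> h; apply/le_anti/andP; split.
  by rewrite -(subrK y x); apply: absD_le => //; exact: ltW.
rewrite leNgt; apply/negP => h'.
suff : abs y < abs y by rewrite ltxx.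
by rewrite -{1}(subKr x y); apply: absD_lt => //; rewrite absN.
Qed.

Lemma abs_prod_1B I (s : seq I) (P : pred I) (f : I -> C) B :
  0 <= B -> B < 1 -> (forall i, P i -> abs (f i) <= B) ->
  abs (\prod_(i <- s | P i) (1 - f i) - 1) <= B.
Proof.
move=> B0 B1 h; elim/big_rec: _ => [|i x Pi hx]; first by rewrite subrr abs0.
rewrite mulrBl mul1r addrAC; apply: absB_le => //.
have -> : abs (f i * x) = abs (f i).
  by rewrite absM (@abs_eq_of_lt x 1) abs1 ?mulr1 // (le_lt_trans hx).
exact: h.
Qed.

Lemma cvg_absP (u : nat -> C) l :
  cvg_abs (@abs R Fq C) u l <->
  forall eps, 0 < eps -> exists N, forall n, (N <= n)%N -> abs (u n - l) < eps.
Proof.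
rewrite /cvg_abs; split.
  move/cvgr0Pnorm_lt => h eps e0; have [N _ hN] := h _ e0.
  exists N => n hn; have := hN n hn.
  by rewrite /= ger0_norm ?abs_ge0.
move=> h; apply/cvgr0Pnorm_lt => eps e0; have [N hN] := h _ e0.
by exists N => // n hn; rewrite /= ger0_norm ?abs_ge0 //; exact: hN.
Qed.

Lemma cvg_abs_shift (u : nat -> C) l d :
  cvg_abs (@abs R Fq C) u l ->
  cvg_abs (@abs R Fq C) (fun n => u (d + n)%N) l.
Proof.
move=> /cvg_absP hu; apply/cvg_absP => eps /hu [N hN].
by exists N => n hn; rewrite hN // (leq_trans hn) // leq_addl.
Qed.

Lemma cvg_abs_unique (u : nat -> C) l l' :
  cvg_abs (@abs R Fq C) u l -> cvg_abs (@abs R Fq C) u l' -> l = l'.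
Proof.
move=> /cvg_absP h /cvg_absP h'; apply/eqP; rewrite -subr_eq0.
apply/negP => /negP; rewrite -abs_gt0 => d0.
have [N hN] := h _ d0; have [N' hN'] := h' _ d0.
suff : abs (l - l') < abs (l - l') by rewrite ltxx.
have := hN _ (leq_maxl N N'); have := hN' _ (leq_maxr N N').
move: (maxn _ _) => n h1 h2; rewrite -{1}(subrK (u n) l) -addrA.
by apply: absD_lt => //; rewrite absB.
Qed.

Lemma cvg_abs_cst x : cvg_abs (@abs R Fq C) (fun=> x) x.
Proof. by apply/cvg_absP => eps e0; exists 0%N => n _; rewrite subrr abs0. Qed.

Lemma cvg_absD (u v : nat -> C) l l' :
  cvg_abs (@abs R Fq C) u l -> cvg_abs (@abs R Fq C) v l' ->
  cvg_abs (@abs R Fq C) (fun n => u n + v n) (l + l').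
Proof.
move=> /cvg_absP hu /cvg_absP hv; apply/cvg_absP => eps e0.
have [N hN] := hu _ e0; have [N' hN'] := hv _ e0.
exists (maxn N N') => n; rewrite geq_max => /andP[Nn N'n].
by rewrite opprD addrACA; apply: absD_lt; [apply: hN|apply: hN'].
Qed.

Lemma cvg_absN (u : nat -> C) l : cvg_abs (@abs R Fq C) u l ->
  cvg_abs (@abs R Fq C) (fun n => - u n) (- l).
Proof.
move=> /cvg_absP hu; apply/cvg_absP => eps /hu [N hN].
by exists N => n /hN; rewrite -opprD absN.
Qed.

Lemma abs_mul_continuous x y eps : 0 < eps -> exists2 d, 0 < d &
  forall x' y', abs (x' - x) < d -> abs (y' - y) < d ->
    abs (x' * y' - x * y) < eps.
Proof.
move=> e0; pose K := 2 + abs x + abs y.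
have hx := abs_ge0 x; have hy := abs_ge0 y.
have K0 : 0 < K by rewrite /K; lra.
exists (Num.min 1 (eps / K)); first by rewrite lt_min ltr01 divr_gt0.
move=> x' y'; rewrite !lt_min => /andP[x1 x2] /andP[_ y2].
have -> : x' * y' - x * y = x' * (y' - y) + (x' - x) * y by ring.
have hx' : abs x' < K.
  have : abs x' <= Num.max 1 (abs x).
    rewrite -(subrK x x'); apply: absD_le; rewrite le_max ?lexx ?orbT //.
    by rewrite (ltW x1).
  by move/le_lt_trans; apply; rewrite gt_max /K; lra.
rewrite ltr_pdivlMr // in x2; rewrite ltr_pdivlMr // in y2.
apply: absD_lt; rewrite absM.
  rewrite (le_lt_trans _ y2) // mulrC ler_wpM2l ?abs_ge0 //; exact: ltW.
rewrite (le_lt_trans _ x2) // ler_wpM2l ?abs_ge0 // /K; lra.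
Qed.

Lemma abs_inv_continuous x eps : x != 0 -> 0 < eps -> exists2 d, 0 < d &
  forall x', abs (x' - x) < d -> abs (x'^-1 - x^-1) < eps.
Proof.
move=> x0 e0; have a0 : 0 < abs x by rewrite abs_gt0.
exists (Num.min (abs x) (eps * abs x ^+ 2)).
  by rewrite lt_min a0 mulr_gt0 // exprn_gt0.
move=> x'; rewrite lt_min => /andP[h1 h2].
have hx' : abs x' = abs x by apply: abs_eq_of_lt.
have x'0 : x' != 0 by rewrite -abs_gt0 hx'.
have -> : x'^-1 - x^-1 = - (x' - x) / (x' * x) by field; rewrite x0.
by rewrite absM absN absV absM hx' ltr_pdivrMr ?mulr_gt0.
Qed.

Lemma cvg_absM (u v : nat -> C) l l' :
  cvg_abs (@abs R Fq C) u l -> cvg_abs (@abs R Fq C) v l' ->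
  cvg_abs (@abs R Fq C) (fun n => u n * v n) (l * l').
Proof.
move=> /cvg_absP hu /cvg_absP hv; apply/cvg_absP => eps e0.
have [d d0 hd] := abs_mul_continuous l l' e0.
have [N hN] := hu _ d0; have [N' hN'] := hv _ d0.
exists (maxn N N') => n; rewrite geq_max => /andP[Nn N'n].
by apply: hd; [apply: hN|apply: hN'].
Qed.

Lemma cvg_absV (u : nat -> C) l : l != 0 ->
  cvg_abs (@abs R Fq C) u l -> cvg_abs (@abs R Fq C) (fun n => (u n)^-1) l^-1.
Proof.
move=> l0 /cvg_absP hu; apply/cvg_absP => eps e0.
have [d d0 hd] := abs_inv_continuous l0 e0.
by have [N hN] := hu _ d0; exists N => n /hN; apply: hd.
Qed.

Lemma cvg_absZ x (u : nat -> C) l : cvg_abs (@abs R Fq C) u l ->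
  cvg_abs (@abs R Fq C) (fun n => x * u n) (x * l).
Proof. by apply: cvg_absM; exact: cvg_abs_cst. Qed.

Lemma cvg_abs_prod I (s : seq I) (P : pred I) (f : I -> nat -> C) (l : I -> C) :
  (forall i, P i -> cvg_abs (@abs R Fq C) (f i) (l i)) ->
  cvg_abs (@abs R Fq C) (fun n => \prod_(i <- s | P i) f i n)
    (\prod_(i <- s | P i) l i).
Proof.
move=> h; elim: s => [|i s IH].
  rewrite big_nil; under eq_fun do rewrite big_nil; exact: cvg_abs_cst.
rewrite big_cons; under eq_fun do rewrite big_cons.
by case: ifPn => [/h hi|_] //; apply: cvg_absM.
Qed.

Lemma cvg_abs_ge (u : nat -> C) l r : 0 < r ->
  cvg_abs (@abs R Fq C) u l -> (forall n, r <= abs (u n)) -> r <= abs l.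
Proof.
move=> r0 /cvg_absP h hr; have [N hN] := h _ r0.
have := hN _ (leqnn N); move/lt_le_trans/(_ (hr N)).
by rewrite absB => /abs_eq_of_lt ->.
Qed.

Lemma closure_abs_continuous1 (A : set C) (f : C -> C) x :
  (forall a, A a -> A (f a)) ->
  (forall eps, 0 < eps -> exists2 d, 0 < d &
     forall x', abs (x' - x) < d -> abs (f x' - f x) < eps) ->
  closure_abs (@abs R Fq C) A x -> closure_abs (@abs R Fq C) A (f x).
Proof.
move=> hA hf hx eps /hf [d d0 hd]; have [a Aa ha] := hx _ d0.
by exists (f a); [exact: hA|rewrite absB hd // absB].
Qed.

Lemma closure_abs_continuous2 (A : set C) (f : C -> C -> C) x y :
  (forall a b, A a -> A b -> A (f a b)) ->
  (forall eps, 0 < eps -> exists2 d, 0 < d & forall x' y',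
     abs (x' - x) < d -> abs (y' - y) < d -> abs (f x' y' - f x y) < eps) ->
  closure_abs (@abs R Fq C) A x -> closure_abs (@abs R Fq C) A y ->
  closure_abs (@abs R Fq C) A (f x y).
Proof.
move=> hA hf hx hy eps /hf [d d0 hd].
have [a Aa ha] := hx _ d0; have [b Ab hb] := hy _ d0.
by exists (f a b); [exact: hA|rewrite absB hd // absB].
Qed.

Lemma Kinf_inK (f : ratfun Fq) : @Kinf R Fq C (inK C f).
Proof. by move=> eps e0; exists (inK C f); rewrite ?subrr ?abs0 //; exists f. Qed.

Lemma KinfD x y : Kinf x -> Kinf y -> Kinf (x + y).
Proof.
apply: (closure_abs_continuous2 (f := +%R)) => [_ _ [a _ <-] [b _ <-]|eps e0].
  by exists (a + b); rewrite ?rmorphD.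
exists eps => // x' y' h1 h2.
by rewrite opprD addrACA; apply: absD_lt.
Qed.

Lemma KinfM x y : Kinf x -> Kinf y -> Kinf (x * y).
Proof.
apply: (closure_abs_continuous2 (f := *%R)) => [_ _ [a _ <-] [b _ <-]|eps e0].
  by exists (a * b); rewrite ?rmorphM.
exact: abs_mul_continuous.
Qed.

Lemma KinfN x : Kinf x -> Kinf (- x).
Proof.
move=> h; rewrite -mulN1r; apply: KinfM => //.
by rewrite -(rmorphN1 (inK C)); exact: Kinf_inK.
Qed.

Lemma KinfV x : Kinf x -> Kinf x^-1.
Proof.
have [->|x0] := eqVneq x 0; first by rewrite invr0.
apply: (closure_abs_continuous1 (f := GRing.inv)) => [_ [a _ <-]|eps e0].
  by exists a^-1; rewrite ?fmorphV.
exact: abs_inv_continuous.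
Qed.

End AbsoluteValue.

(** * Lattice products and exponentials *)

Section LatticeExponential.
Variables (R : realType) (Fq : finFieldType) (C : Cinf R Fq).
Implicit Types (x y z : C) (r B eps : R) (c : ratfun Fq).
Local Notation q := #|Fq|.

HB.instance Definition _ := GRing.RMorphism.copy (@inA R Fq C)
  (inK C \o @FracField.tofrac {poly Fq}).

Lemma inA_eq0 (f : {poly Fq}) : (@inA R Fq C f == 0) = (f == 0).
Proof. by rewrite fmorph_eq0 tofrac_eq0. Qed.

Lemma card_ge2 : (2 <= q)%N. Proof. exact: card_finNzRing_gt1. Qed.

Lemma q_ge1 : 1 <= q%:R :> R.
Proof. by rewrite ler1n ltnW // card_ge2. Qed.

Lemma abs_inA_ge d (f : {poly Fq}) : (d < size f)%N ->
  q%:R ^+ d <= abs (@inA R Fq C f).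
Proof.
move=> df; have f0 : f != 0 by rewrite -size_poly_gt0 (leq_ltn_trans _ df).
rewrite abs_deg // ler_weXn2l ?q_ge1 //.
by rewrite -ltnS prednK // size_poly_gt0.
Qed.

Lemma abs_inA_ge1 (f : {poly Fq}) : f != 0 -> 1 <= abs (@inA R Fq C f).
Proof. by move=> f0; rewrite -[1](expr0 q%:R) abs_inA_ge // size_poly_gt0. Qed.

Lemma expq_unbounded B : exists d, B < q%:R ^+ d.
Proof.
exists (Num.bound B); apply: (lt_le_trans (y := (Num.bound B)%:R)).
  have := archi_boundP (normr_ge0 B); rewrite /Num.bound normr_id.
  exact: le_lt_trans (ler_norm B).
by rewrite -natrX ler_nat ltnW // ltn_expl // card_ge2.
Qed.

Definition lattice_pt c d (a : 'rV[Fq]_d) : C := inK C c * inA C (rVpoly a).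

Lemma lattice_prodE c z d : lattice_prod c z d =
  z * \prod_(a : 'rV[Fq]_d | a != 0) (1 - z / lattice_pt c a).
Proof. by []. Qed.

Lemma lattice_ptD c d (a b : 'rV[Fq]_d) :
  lattice_pt c (a + b) = lattice_pt c a + lattice_pt c b.
Proof. by rewrite /lattice_pt linearD rmorphD mulrDr. Qed.

Lemma lattice_pt0 c d : lattice_pt c (0 : 'rV[Fq]_d) = 0.
Proof. by rewrite /lattice_pt linear0 rmorph0 mulr0. Qed.

Lemma rVpoly_eq0 d (a : 'rV[Fq]_d) : (rVpoly a == 0) = (a == 0).
Proof. by rewrite -(inj_eq (can_inj rVpolyK)) linear0. Qed.

Lemma lattice_pt_eq0 c d (a : 'rV[Fq]_d) : c != 0 ->
  (lattice_pt c a == 0) = (a == 0).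
Proof.
move=> c0; rewrite mulf_eq0 fmorph_eq0 (negPf c0) /=.
by rewrite inA_eq0 rVpoly_eq0.
Qed.

Lemma lattice_pt_inj c d : c != 0 -> injective (@lattice_pt c d).
Proof.
move=> c0 a b /eqP; rewrite -subr_eq0 -mulrBr -rmorphB -linearB.
by rewrite [_ == 0](lattice_pt_eq0 _ c0) subr_eq0 => /eqP.
Qed.

Lemma lattice_pt_Kinf c d (a : 'rV[Fq]_d) : Kinf (lattice_pt c a).
Proof. by apply: KinfM; exact: Kinf_inK. Qed.

Lemma lattice_prod_monic c z d : c != 0 -> lattice_prod c z d =
  (\prod_(a : 'rV[Fq]_d | a != 0) - lattice_pt c a)^-1 *
  \prod_(a : 'rV[Fq]_d) (z - lattice_pt c a).
Proof.
move=> c0; rewrite lattice_prodE [X in _ = _ * X](bigD1 (0 : 'rV_d)) //=.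
rewrite lattice_pt0 subr0 mulrCA -prodfV -big_split /=.
congr (_ * _); apply: eq_bigr => a a0.
have h : lattice_pt c a != 0 by rewrite lattice_pt_eq0.
by rewrite invrN mulNr mulrBr mulVf // opprB mulrC.
Qed.

Lemma lattice_prod_periodic c z d (b : 'rV[Fq]_d) : c != 0 ->
  lattice_prod c (z - lattice_pt c b) d = lattice_prod c z d.
Proof.
move=> c0; rewrite !lattice_prod_monic //; congr (_ * _).
rewrite [RHS](reindex_inj (addrI b)) /=; apply: eq_bigr => a _.
by rewrite lattice_ptD opprD addrA.
Qed.

(* If z is moved by the lattice point nearest to it, all factors of the product
   have absolute value at least 1. *)
Lemma abs_lattice_prod_ge c z d r : c != 0 ->
  (forall a : 'rV[Fq]_d, r <= abs (z - lattice_pt c a)) ->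
  r <= abs (lattice_prod c z d).
Proof.
move=> c0 hr.
pose b := [arg min_(i < (0 : 'rV[Fq]_d)) abs (z - lattice_pt c i)]%O.
have hb (a : 'rV[Fq]_d) : abs (z - lattice_pt c b) <= abs (z - lattice_pt c a).
  rewrite /b; case: (@arg_minP _ _ _ (0 : 'rV[Fq]_d) xpredT
    (fun i => abs (z - lattice_pt c i)) isT) => i _ h.
  exact: h.
rewrite -(lattice_prod_periodic z b c0) lattice_prodE absM.
apply: (le_trans (hr b)); rewrite ler_peMr ?abs_ge0 //.
rewrite abs_prod.
suff: forall a : 'rV[Fq]_d, a != 0 ->
    1 <= abs (1 - (z - lattice_pt c b) / lattice_pt c a).
  move=> h; elim/big_rec: _ => // a x /h ha hx.
  by rewrite -[1]mulr1 ler_pM ?ler01.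
move=> a a0; have h : lattice_pt c a != 0 by rewrite lattice_pt_eq0.
rewrite -[X in abs (X - _)](mulfV h) -mulrBl absM absV.
rewrite ler_pdivlMr ?abs_gt0 // mul1r.
have h1 : abs (z - lattice_pt c b) <=
    abs (lattice_pt c a - (z - lattice_pt c b)).
  rewrite (le_trans (hb (b + a))) // lattice_ptD opprD addrA.
  by rewrite absB.
by rewrite -{1}(subrK (z - lattice_pt c b) (lattice_pt c a)) absD_le.
Qed.

Section Decomposition.
Variables (s d : nat) (g : {poly Fq}).
Hypothesis size_g : size g = s.+1.

Definition rV_glue (ba : 'rV[Fq]_s * 'rV[Fq]_d) : 'rV[Fq]_(s + d) :=
  poly_rV (rVpoly ba.1 + g * rVpoly ba.2).

Lemma rVpoly_glue ba : rVpoly (rV_glue ba) = rVpoly ba.1 + g * rVpoly ba.2.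
Proof.
apply: poly_rV_K; rewrite (leq_trans (size_polyD _ _)) // geq_max.
rewrite (leq_trans (size_poly _ _)) ?leq_addr //=.
rewrite (leq_trans (size_polyMleq _ _)) // size_g /=.
by rewrite leq_add2l size_poly.
Qed.

Lemma size_glue (b : 'rV[Fq]_s) (a : 'rV[Fq]_d) : a != 0 ->
  (s < size (rVpoly b + g * rVpoly a)%R)%N.
Proof.
rewrite -rVpoly_eq0 => a0.
have g0 : g != 0 by rewrite -size_poly_gt0 size_g.
have h : (s < size (g * rVpoly a)%R)%N.
  rewrite size_mul // size_g /= -[X in (X < _)%N]addn0 ltn_add2l.
  by rewrite size_poly_gt0.
by rewrite addrC size_polyDl // (leq_ltn_trans (size_poly _ _)).
Qed.

Lemma rV_glue_inj : injective rV_glue.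
Proof.
move=> [b a] [b' a'] /(congr1 rVpoly); rewrite !rVpoly_glue /= => h.
have h0 : rVpoly (b - b') + g * rVpoly (a - a') = 0.
  by rewrite !linearB /= mulrBr addrACA h -opprD subrr.
have aa' : a = a'.
  apply/eqP; rewrite -subr_eq0; apply/negP => /negP /(size_glue (b - b')).
  by rewrite h0 size_poly0.
move: h0; rewrite aa' subrr linear0 mulr0 addr0 => /eqP.
by rewrite rVpoly_eq0 subr_eq0 => /eqP ->.
Qed.

Lemma rV_glue_bij : bijective rV_glue.
Proof.
apply: inj_card_bij; first exact: rV_glue_inj.
by rewrite card_prod !card_mx !mul1n expnD.
Qed.

Lemma rV_glue_eq0 ba : (rV_glue ba == 0) = (ba == 0).
Proof.
rewrite -(inj_eq rV_glue_inj) [rV_glue 0](_ : _ = 0) //.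
by apply: (can_inj rVpolyK); rewrite rVpoly_glue /= !linear0 mulr0 addr0.
Qed.

Lemma prod_glue (f : {poly Fq} -> C) :
  \prod_(x : 'rV[Fq]_(s + d) | x != 0) f (rVpoly x) =
  \prod_(ba : 'rV[Fq]_s * 'rV[Fq]_d | ba != 0)
     f (rVpoly ba.1 + g * rVpoly ba.2).
Proof.
rewrite (reindex rV_glue) /=; last exact/onW_bij/rV_glue_bij.
by apply: eq_big => ba; [rewrite rV_glue_eq0|rewrite rVpoly_glue].
Qed.

Lemma prod_glue_l (f : {poly Fq} -> C) :
  \prod_(x : 'rV[Fq]_(s + d) | x != 0) f (rVpoly x) =
  \prod_(a : 'rV[Fq]_d | a != 0) f (g * rVpoly a) *
  \prod_(b : 'rV[Fq]_s | b != 0)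
     \prod_(a : 'rV[Fq]_d) f (rVpoly b + g * rVpoly a).
Proof.
rewrite prod_glue -(pair_big_dep xpredT (fun b a => (b, a) != 0)
  (fun b a => f (rVpoly b + g * rVpoly a))) /=.
rewrite (bigD1 (0 : 'rV[Fq]_s)) //=; congr (_ * _).
  apply: eq_big => [a|a _]; first by rewrite -pair_eqE /= eqxx.
  by rewrite linear0 add0r.
apply: eq_bigr => b b0; apply: eq_bigl => a.
by rewrite -pair_eqE /= (negPf b0).
Qed.

Lemma prod_glue_r (f : {poly Fq} -> C) :
  \prod_(x : 'rV[Fq]_(s + d) | x != 0) f (rVpoly x) =
  \prod_(b : 'rV[Fq]_s | b != 0) f (rVpoly b) *
  \prod_(ba : 'rV[Fq]_s * 'rV[Fq]_d | ba.2 != 0)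
     f (rVpoly ba.1 + g * rVpoly ba.2).
Proof.
rewrite prod_glue (bigID (fun ba => ba.2 == 0)) /=; congr (_ * _); last first.
  by apply: eq_bigl => -[b a]; rewrite -pair_eqE /= negb_and andb_orl /=;
     case: (a == 0); rewrite ?andbF ?andbT ?orbT.
rewrite (reindex (fun b : 'rV[Fq]_s => (b, 0 : 'rV[Fq]_d))) /=.
  apply: eq_big => [b|b _]; first by rewrite -pair_eqE /= eqxx !andbT.
  by rewrite linear0 mulr0 addr0.
by exists fst => [b _|[b a]] //=; rewrite inE => /andP[_ /eqP /= ->].
Qed.

End Decomposition.
End LatticeExponential.

Section LatticeExponentialLimit.
Variables (R : realType) (Fq : finFieldType) (C : Cinf R Fq).
Implicit Types (x y z w : C) (r B eps : R) (c : ratfun Fq).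
Local Notation q := #|Fq|.

Lemma scale_lattice_neq0 c (g : {poly Fq}) :
  c != 0 -> g != 0 -> c * FracField.tofrac g != 0.
Proof. by move=> c0 g0; rewrite mulf_eq0 tofrac_eq0 negb_or c0. Qed.

(* Both sides are polynomials in z of degree q ^ d with the same q ^ d roots
   and the same value at 0. *)
Lemma prod_lattice_shift c z w d : c != 0 ->
  (forall a : 'rV[Fq]_d, w + lattice_pt C c a != 0) ->
  \prod_(a : 'rV[Fq]_d) (1 - z / (w + lattice_pt C c a)) =
  1 - lattice_prod c z d / lattice_prod c w d.
Proof.
move=> c0 hw.
pose K1 := \prod_(a : 'rV[Fq]_d) - (w + lattice_pt C c a)^-1.
pose K2 := (\prod_(a : 'rV[Fq]_d | a != 0) - lattice_pt C c a)^-1.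
pose P1 := \prod_(a : 'rV[Fq]_d) ('X - (w + lattice_pt C c a)%:P).
pose P2 := \prod_(a : 'rV[Fq]_d) ('X - (lattice_pt C c a)%:P).
pose p := K1 *: P1 - 1 + (K2 / lattice_prod c w d) *: P2.
have e1 x : \prod_(a : 'rV[Fq]_d) (1 - x / (w + lattice_pt C c a)) =
    K1 * P1.[x].
  rewrite horner_prod -big_split /=; apply: eq_bigr => a _.
  by rewrite !hornerE mulNr mulrBr mulVf // opprB mulrC.
have e2 x : lattice_prod c x d = K2 * P2.[x].
  rewrite lattice_prod_monic // horner_prod; congr (_ * _).
  by apply: eq_bigr => a _; rewrite !hornerE.
have ev x : p.[x] = \prod_(a : 'rV[Fq]_d) (1 - x / (w + lattice_pt C c a)) - 1
    + lattice_prod c x d / lattice_prod c w d.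
  by rewrite !hornerE e1 [lattice_prod c x d]e2 mulrAC.
suff p0 : p = 0.
  have := ev z; rewrite p0 horner0 => /esym/eqP.
  by rewrite -addrA addr_eq0 opprD opprK => /eqP.
have lw0 : lattice_prod c w d != 0.
  rewrite lattice_prodE mulf_neq0 //.
    by have := hw 0; rewrite lattice_pt0 addr0.
  apply/prodf_neq0 => a a0; have h : lattice_pt C c a != 0.
    by rewrite lattice_pt_eq0.
  rewrite -[1](mulfV h) -mulrBl mulf_neq0 ?invr_eq0 //.
  rewrite -oppr_eq0 opprB; have := hw (- a).
  by rewrite /lattice_pt linearN rmorphN mulrN.
have szP (f : 'rV[Fq]_d -> C) :
    size (\prod_a ('X - (f a)%:P)) = (#|{: 'rV[Fq]_d}|).+1.
  by rewrite size_prod_XsubC -[index_enum _]enumT -cardT.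
apply: (@roots_geq_poly_eq0 _ _
  (0 :: [seq w + lattice_pt C c a | a : 'rV[Fq]_d])).
- apply/andP; split.
    rewrite rootE ev lattice_prodE !mul0r addr0 subr_eq0.
    by apply/eqP; apply: big1 => a _; rewrite mul0r subr0.
  apply/allP => _ /mapP[a _ ->]; rewrite rootE ev.
  rewrite (bigD1 a) //= mulfV // subrr mul0r sub0r.
  rewrite -(lattice_prod_periodic (w + lattice_pt C c a) a c0) addrK.
  by rewrite mulfV // addNr.
- rewrite /= map_inj_uniq ?enum_uniq ?andbT.
    by apply/mapP => -[a _ /esym/eqP]; apply/negP.
  by move=> a b /addrI /(lattice_pt_inj c0).
rewrite /= size_map -cardT (leq_trans (size_polyD _ _)) // geq_max.
rewrite (leq_trans (size_scale_leq _ _)) ?szP // andbT.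
rewrite (leq_trans (size_polyD _ _)) // geq_max.
by rewrite (leq_trans (size_scale_leq _ _)) ?szP // size_polyN size_poly1.
Qed.

Lemma lattice_prod_scale c z (g : {poly Fq}) s d : c != 0 ->
  size g = s.+1 ->
  lattice_prod c z (s + d) =
  lattice_prod (c * FracField.tofrac g) z d *
  \prod_(b : 'rV[Fq]_s | b != 0)
    (1 - lattice_prod (c * FracField.tofrac g) z d /
         lattice_prod (c * FracField.tofrac g) (lattice_pt C c b) d).
Proof.
move=> c0 sg; set c' := c * _.
have g0 : g != 0 by rewrite -size_poly_gt0 sg.
have c'0 : c' != 0 := scale_lattice_neq0 c0 g0.
have pt' (a : 'rV[Fq]_d) : inK C c * inA C (g * rVpoly a) = lattice_pt C c' a.
  by rewrite /lattice_pt /c' [inA C (g * _)]rmorphM rmorphM mulrA.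
rewrite lattice_prodE (prod_glue_l d sg (fun p => 1 - z / (inK C c * inA C p))).
rewrite mulrA; congr (_ * _); first by under eq_bigr do rewrite pt'.
apply: eq_bigr => b b0; under eq_bigr do rewrite rmorphD mulrDr pt'.
rewrite -prod_lattice_shift // => a.
have -> : lattice_pt C c b + lattice_pt C c' a =
    inK C c * inA C (rVpoly b + g * rVpoly a).
  by rewrite -pt' rmorphD mulrDr.
rewrite mulf_eq0 fmorph_eq0 (negPf c0) /= inA_eq0 -size_poly_gt0.
have [->|a0] := eqVneq a 0.
  by rewrite linear0 mulr0 addr0 size_poly_gt0 rVpoly_eq0.
exact: leq_ltn_trans (size_glue sg _ a0).
Qed.

Lemma lattice_prod_tail c z d e B : c != 0 ->
  abs z / (abs (inK C c) * q%:R ^+ d) <= B -> B < 1 ->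
  abs (lattice_prod c z (d + e) - lattice_prod c z d) <=
  abs (lattice_prod c z d) * B.
Proof.
move=> c0 hB B1.
have k0 : 0 < abs (inK C c) by rewrite abs_gt0 fmorph_eq0.
have qd0 : 0 < q%:R ^+ d :> R by rewrite exprn_gt0 // (lt_le_trans ltr01) ?q_ge1.
have B0 : 0 <= B.
  by apply: le_trans hB; rewrite divr_ge0 ?abs_ge0 ?mulr_ge0 // ltW.
have sX : size ('X^d : {poly Fq}) = d.+1 by rewrite size_polyXn.
rewrite lattice_prodE (prod_glue_r e sX (fun p => 1 - z / (inK C c * inA C p))).
rewrite mulrA -[X in _ - X]mulr1 -mulrBr absM ler_wpM2l ?abs_ge0 //.
apply: abs_prod_1B => // -[b a] /= a0.
rewrite absM absV; apply: le_trans hB.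
rewrite ler_wpM2l ?abs_ge0 // lef_pV2 ?posrE ?mulr_gt0 //; last first.
  rewrite abs_gt0 mulf_eq0 fmorph_eq0 (negPf c0) /= inA_eq0.
  by rewrite -size_poly_gt0 (leq_ltn_trans _ (size_glue sX b a0)).
by rewrite absM ler_wpM2l ?(ltW k0) // abs_inA_ge // size_glue.
Qed.

Lemma lattice_prod_tail_bound c z eps : c != 0 -> 0 < eps ->
  exists d, abs z / (abs (inK C c) * q%:R ^+ d) <= eps.
Proof.
move=> c0 e0; have k0 : 0 < abs (inK C c) by rewrite abs_gt0 fmorph_eq0.
have [d hd] := @expq_unbounded R Fq (abs z / abs (inK C c) / eps).
exists d; rewrite invfM mulrA ler_pdivrMr.
  by rewrite [eps * _]mulrC -ler_pdivrMr // ltW.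
by rewrite exprn_gt0 // (lt_le_trans ltr01) ?q_ge1.
Qed.

Lemma lattice_prod_cauchy c z : c != 0 ->
  cauchy_abs (@abs R Fq C) (lattice_prod c z).
Proof.
move=> c0 eps e0.
have [|d0 hd0] := @lattice_prod_tail_bound c z (2^-1) c0; first by rewrite invr_gt0.
pose A := abs (lattice_prod c z d0) + 1.
have A0 : 0 < A by rewrite ltr_wpDl ?abs_ge0.
have hA e : abs (lattice_prod c z (d0 + e)) <= A.
  rewrite -(subrK (lattice_prod c z d0) (lattice_prod c z (d0 + e))).
  apply: absD_le; last by rewrite lerDl.
  apply: le_trans (lattice_prod_tail e c0 hd0 _) _; first by lra.
  have := abs_ge0 (lattice_prod c z d0); rewrite /A; lra.
pose B := Num.min 2^-1 (eps / (2 * A)).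
have B0 : 0 < B by rewrite lt_min invr_gt0 ltr0n divr_gt0 // mulr_gt0.
have [d1 hd1] := @lattice_prod_tail_bound c z B c0 B0.
pose d := (d0 + d1)%N.
have hd : abs z / (abs (inK C c) * q%:R ^+ d) <= B.
  apply: le_trans hd1; rewrite ler_wpM2l ?abs_ge0 //.
  have h n : 0 < abs (inK C c) * q%:R ^+ n.
    rewrite mulr_gt0 ?abs_gt0 ?fmorph_eq0 // exprn_gt0 //.
    by rewrite (lt_le_trans ltr01) ?q_ge1.
  rewrite lef_pV2 ?posrE ?h // ler_wpM2l ?abs_ge0 //.
  by rewrite ler_weXn2l ?q_ge1 // /d leq_addl.
have hB1 : B < 1 by rewrite gt_min; apply/orP; left; lra.
have small n : (d <= n)%N ->
    abs (lattice_prod c z n - lattice_prod c z d) < eps.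
  move=> dn; rewrite -(subnKC dn).
  apply: le_lt_trans (lattice_prod_tail _ c0 hd hB1) _.
  apply: (@le_lt_trans _ _ (A * (eps / (2 * A)))).
    by rewrite ler_pM ?abs_ge0 ?hA ?(ltW B0) // ge_min lexx orbT.
  by rewrite (_ : A * _ = eps / 2); [lra|field; rewrite gt_eqF].
exists d => i j hi hj; rewrite -(subrK (lattice_prod c z d) (lattice_prod c z i)).
by rewrite -addrA; apply: absD_lt; [exact: small|rewrite absB; exact: small].
Qed.

Lemma lattice_exp_cvg c z : c != 0 ->
  cvg_abs (@abs R Fq C) (lattice_prod c z) (lattice_exp c z).
Proof.
move=> c0; have [l hl] := abs_complete (lattice_prod_cauchy z c0).
by rewrite /lattice_exp; case: xgetP => [x -> //|/(_ l)].
Qed.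

Lemma abs_lattice_exp_ge c z r : c != 0 -> 0 < r ->
  (forall d (a : 'rV[Fq]_d), r <= abs (z - lattice_pt C c a)) ->
  r <= abs (lattice_exp c z).
Proof.
move=> c0 r0 h; apply: (cvg_abs_ge r0 (lattice_exp_cvg z c0)) => d.
exact: abs_lattice_prod_ge.
Qed.

Lemma lattice_exp_imag_ge c r (z : Omega C) : c != 0 -> 0 < r ->
  imag_ge r z -> r <= abs (lattice_exp c (val z)).
Proof.
by move=> c0 r0 h; apply: abs_lattice_exp_ge => // d a; exact/h/lattice_pt_Kinf.
Qed.

Lemma lattice_exp_neq0 c r (z : Omega C) : c != 0 -> 0 < r ->
  imag_ge r z -> lattice_exp c (val z) != 0.
Proof.
move=> c0 r0 h; rewrite -abs_gt0.
exact: lt_le_trans r0 (lattice_exp_imag_ge c0 r0 h).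
Qed.

Lemma lattice_exp_pt_neq0 c (g : {poly Fq}) s (b : 'rV[Fq]_s) : c != 0 ->
  size g = s.+1 -> b != 0 ->
  lattice_exp (c * FracField.tofrac g) (lattice_pt C c b) != 0.
Proof.
move=> c0 sg b0.
have g0 : g != 0 by rewrite -size_poly_gt0 sg.
have k0 : 0 < abs (inK C c) by rewrite abs_gt0 fmorph_eq0.
rewrite -abs_gt0; apply: (lt_le_trans k0).
have c'0 := scale_lattice_neq0 c0 g0.
apply: (abs_lattice_exp_ge c'0 k0) => d a.
 have -> : lattice_pt C c b - lattice_pt C (c * FracField.tofrac g) a =
    inK C c * inA C (rVpoly b + g * rVpoly (- a)).
  rewrite linearN mulrN rmorphB mulrBr; congr (_ - _).
  by rewrite /lattice_pt [inK C (_ * _)]rmorphM -mulrA [in RHS]rmorphM.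
rewrite absM ler_peMr ?abs_ge0 //; apply: abs_inA_ge1.
have [->|a0] := eqVneq a 0.
  by rewrite oppr0 linear0 mulr0 addr0 rVpoly_eq0.
by rewrite -size_poly_gt0 (leq_ltn_trans _ (size_glue sg b _)) ?oppr_eq0.
Qed.

Lemma lattice_exp_scale c z (g : {poly Fq}) s : c != 0 -> size g = s.+1 ->
  lattice_exp c z =
  lattice_exp (c * FracField.tofrac g) z *
  \prod_(b : 'rV[Fq]_s | b != 0)
    (1 - lattice_exp (c * FracField.tofrac g) z /
         lattice_exp (c * FracField.tofrac g) (lattice_pt C c b)).
Proof.
move=> c0 sg; have g0 : g != 0 by rewrite -size_poly_gt0 sg.
have c'0 := scale_lattice_neq0 c0 g0.
apply: cvg_abs_unique (cvg_abs_shift s (lattice_exp_cvg z c0)) _.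
under eq_fun do rewrite (lattice_prod_scale _ _ c0 sg).
apply: cvg_absM; first exact: lattice_exp_cvg.
apply: cvg_abs_prod => b b0; apply: cvg_absD; first exact: cvg_abs_cst.
apply: cvg_absN; apply: cvg_absM; first exact: lattice_exp_cvg.
have h := lattice_exp_pt_neq0 c0 sg b0.
by apply: (cvg_absV h); exact: (lattice_exp_cvg _ c'0).
Qed.

End LatticeExponentialLimit.

(** * Power series and expansions at the cusps *)

Lemma frac_numden (D : idomainType) (c : {fraction D}) : exists x y : D,
  y != 0 /\ c = FracField.tofrac x / FracField.tofrac y.
Proof.
elim/quotW: c => r; exists (frac r).1, (frac r).2; have r0 := denom_ratioP r.
split=> //; apply: (canRL (mulfK _)); first by rewrite tofrac_eq0.
unlock FracField.tofrac; rewrite -[X in X = _]/(FracField.mul _ _) !piE.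
apply/eqmodP; rewrite /= FracField.equivfE /FracField.mulf.
by rewrite !numden_Ratio ?oner_eq0 ?mulr1 ?mulf_neq0 // mulrC.
Qed.

Section PowerSeries.
Variables (R : realType) (Fq : finFieldType) (C : Cinf R Fq).
Implicit Types (V W : nat -> C) (u v w : C) (M B : R).

Definition partial_sum V u N : C := \sum_(n < N) V n * u ^+ n.

Definition coef_le M V := forall n, abs (V n) <= M ^+ n.

Definition expands M V u v :=
  forall N, abs (v - partial_sum V u N) <= (M * abs u) ^+ N.

Definition series_mul V W n := \sum_(i < n.+1) V i * W (n - i)%N.

Definition series1 n : C := (n == 0%N)%:R.

Definition series_exp V i := iter i (series_mul V) series1.

Lemma partial_sumE V u N : partial_sum V u N = (\poly_(n < N) V n).[u].
Proof. by rewrite horner_poly. Qed.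

Lemma coef_le_mul M V W : 0 <= M -> coef_le M V -> coef_le M W ->
  coef_le M (series_mul V W).
Proof.
move=> M0 hV hW n; apply: abs_sum_le => [|i _]; first exact: exprn_ge0.
have le_in : (i <= n)%N by rewrite -ltnS.
by rewrite absM -[X in _ ^+ X](subnKC le_in) exprD ler_pM ?abs_ge0.
Qed.

Lemma coef_le1 M : 0 <= M -> coef_le M series1.
Proof.
move=> M0 [|n]; first by rewrite /series1 eqxx abs1 expr0.
by rewrite /series1 abs0 exprn_ge0.
Qed.

Lemma abs_term_le M V u n : coef_le M V ->
  abs (V n * u ^+ n) <= (M * abs u) ^+ n.
Proof.
move=> hV; rewrite absM absX exprMn ler_wpM2r //.
by rewrite exprn_ge0 // abs_ge0.
Qed.

Lemma abs_partial_sum_le1 M V u N : 0 <= M -> M * abs u <= 1 ->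
  coef_le M V -> abs (partial_sum V u N) <= 1.
Proof.
move=> M0 Mu hV; apply: abs_sum_le => // n _.
by rewrite (le_trans (abs_term_le _ _ hV)) // exprn_ile1 // mulr_ge0 ?abs_ge0.
Qed.

Lemma partial_sum_mul M V W u N : 0 <= M -> M * abs u <= 1 ->
  coef_le M V -> coef_le M W ->
  abs (partial_sum V u N * partial_sum W u N
       - partial_sum (series_mul V W) u N) <= (M * abs u) ^+ N.
Proof.
move=> M0 Mu hV hW.
have Mu0 : 0 <= M * abs u by rewrite mulr_ge0 ?abs_ge0.
rewrite (partial_sumE V) (partial_sumE W) -hornerM.
set P := \poly_(n < N) V n; set Q := \poly_(n < N) W n.
have szPQ : (size (P * Q)%R <= N + N)%N.
  rewrite (leq_trans (size_polyMleq _ _)) // (leq_trans (leq_pred _)) //.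
  by rewrite leq_add // size_poly.
rewrite (horner_coef_wide _ szPQ) big_split_ord /=.
have hp n : abs (P`_n) <= M ^+ n.
  by rewrite coef_poly; case: ifP => _ //; rewrite abs0 exprn_ge0.
have hq n : abs (Q`_n) <= M ^+ n.
  by rewrite coef_poly; case: ifP => _ //; rewrite abs0 exprn_ge0.
have hpq : coef_le M (fun n => (P * Q)`_n).
  by move=> n; rewrite coefM; apply: (coef_le_mul M0 hp hq).
have -> : \sum_(i < N) (P * Q)`_(lshift N i) * u ^+ (lshift N i) =
    partial_sum (series_mul V W) u N.
  apply: eq_bigr => n _; congr (_ * _); rewrite coefM; apply: eq_bigr => i _.
  have hn := ltn_ord n; have hi := ltn_ord i.
  rewrite !coef_poly (_ : (i < N)%N); last by rewrite /= in hi *; lia.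
  by rewrite (_ : (n - i < N)%N) //; rewrite /= in hi *; lia.
rewrite addrAC subrr add0r; apply: abs_sum_le => [|i _]; first exact: exprn_ge0.
rewrite (le_trans (abs_term_le _ _ hpq)) //= exprD ler_piMr ?exprn_ge0 //.
exact: exprn_ile1.
Qed.

Lemma expandsM M V W u v w : 0 <= M -> M * abs u <= 1 ->
  coef_le M V -> coef_le M W -> expands M V u v -> expands M W u w ->
  expands M (series_mul V W) u (v * w).
Proof.
move=> M0 Mu hV hW ev ew N.
have h0 : 0 <= (M * abs u) ^+ N by rewrite exprn_ge0 // mulr_ge0 ?abs_ge0.
have v1 : abs v <= 1.
  by have := ev 0%N; rewrite /partial_sum big_ord0 subr0 expr0.
have w1 := abs_partial_sum_le1 N M0 Mu hW.
have -> : v * w - partial_sum (series_mul V W) u N =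
    v * (w - partial_sum W u N) +
    ((v - partial_sum V u N) * partial_sum W u N +
    (partial_sum V u N * partial_sum W u N - partial_sum (series_mul V W) u N)).
  by ring.
apply: absD_le; last apply: absD_le; last exact: partial_sum_mul.
  by rewrite absM -[X in _ <= X]mul1r ler_pM ?abs_ge0.
by rewrite absM -[X in _ <= X]mulr1 ler_pM ?abs_ge0.
Qed.

Lemma expandsB M V W u v w : expands M V u v -> expands M W u w ->
  expands M (fun n => V n - W n) u (v - w).
Proof.
move=> ev ew N.
rewrite (_ : partial_sum _ u N = partial_sum V u N - partial_sum W u N).
  rewrite (_ : _ - _ = (v - partial_sum V u N) - (w - partial_sum W u N)).
    exact: absB_le.
  by ring.
by rewrite /partial_sum -sumrB; apply: eq_bigr => n _; rewrite mulrBl.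
Qed.

Lemma expands1 M u : 0 <= M -> expands M series1 u 1.
Proof.
move=> M0 [|N]; rewrite /partial_sum; first by rewrite big_ord0 subr0 abs1 expr0.
rewrite big_ord_recl big1 => [|i _]; last by rewrite /series1 mul0r.
rewrite /series1 /= expr0 mulr1 addr0 subrr abs0.
by rewrite exprn_ge0 // mulr_ge0 ?abs_ge0.
Qed.

Lemma expands_id M u : 1 <= M -> M * abs u <= 1 ->
  expands M (fun n => (n == 1%N)%:R) u u.
Proof.
move=> M1 Mu; have M0 : 0 <= M by apply: le_trans M1.
have leu : abs u <= M * abs u by rewrite ler_peMl ?abs_ge0.
case=> [|[|N]]; rewrite /partial_sum.
- by rewrite big_ord0 subr0 expr0 (le_trans leu).
- by rewrite big_ord1 mul0r subr0 expr1.
rewrite big_ord_recl mul0r add0r big_ord_recl big1 => [|i _]; last by rewrite mul0r.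
by rewrite /= expr1 mul1r addr0 subrr abs0 exprn_ge0 // mulr_ge0 ?abs_ge0.
Qed.

Lemma coef_le_id M : 1 <= M -> coef_le M (fun n => (n == 1%N)%:R).
Proof.
move=> M1 n; case: eqP => [->|_]; first by rewrite abs1 expr1.
by rewrite abs0 exprn_ge0 // (le_trans _ M1).
Qed.

Lemma expands_geometric M u w : abs w <= M -> M * abs u < 1 ->
  expands M (fun n => w ^+ n) u (1 - w * u)^-1.
Proof.
move=> wM Mu N.
have hwu : abs (w * u) <= M * abs u by rewrite absM ler_wpM2r ?abs_ge0.
have h1 : abs (1 - w * u) = 1.
  rewrite -[RHS](@abs1 R Fq C); apply: abs_eq_of_lt.
  by rewrite addrAC subrr sub0r absN abs1 (le_lt_trans hwu).
have h0 : 1 - w * u != 0 by rewrite -abs_neq0 h1 oner_eq0.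
have -> : partial_sum (fun n => w ^+ n) u N =
    (1 - w * u)^-1 * (1 - (w * u) ^+ N).
  apply: (mulfI h0); rewrite mulrA mulfV // mul1r -[X in _ = X - _](expr1n _ N).
  rewrite subrXX; congr (_ * _); apply: eq_bigr => i _.
  by rewrite expr1n mul1r exprMn.
rewrite mulrBr mulr1 opprB addrC subrK absM absV h1 invr1 mul1r absX.
by rewrite lerXn2r ?nnegrE ?abs_ge0 // (le_trans _ hwu) ?abs_ge0.
Qed.

Lemma series_exp_order V i n : V 0%N = 0 -> (n < i)%N -> series_exp V i n = 0.
Proof.
move=> V0; elim: i n => [//|i IH] n hn; rewrite /series_exp iterS.
apply: big1 => -[[|k] hk] _ /=; first by rewrite V0 mul0r.
by rewrite [iter _ _ _ _]IH ?mulr0 //; lia.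
Qed.

Lemma coef_le_exp M V i : 0 <= M -> coef_le M V -> coef_le M (series_exp V i).
Proof.
move=> M0 hV; elim: i => [|i IH]; first exact: coef_le1.
exact: coef_le_mul.
Qed.

Lemma expandsX M V u v i : 0 <= M -> M * abs u <= 1 -> coef_le M V ->
  expands M V u v -> expands M (series_exp V i) u (v ^+ i).
Proof.
move=> M0 Mu hV ev; elim: i => [|i IH]; first exact: expands1.
by rewrite exprS; apply: expandsM => //; exact: coef_le_exp.
Qed.

Definition series_comp (a : nat -> C) V n :=
  \sum_(i < n.+1) a i * series_exp V i n.

Lemma partial_sum_comp (a : nat -> C) V u N : V 0%N = 0 ->
  partial_sum (series_comp a V) u N =
  \sum_(i < N) a i * partial_sum (series_exp V i) u N.
Proof.
move=> V0; under [RHS]eq_bigr do rewrite mulr_sumr.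
rewrite [RHS]exchange_big /=; apply: eq_bigr => n _.
rewrite /series_comp mulr_suml (big_ord_widen_cond N xpredT
  (fun i => a i * series_exp V i n * u ^+ n)) //= big_mkcond /=.
apply: eq_bigr => i _; rewrite mulrA; case: ltnP => // hi.
by rewrite series_exp_order // mulr0 mul0r.
Qed.

Lemma expr_cvg0 (x eps : R) : 0 <= x -> x < 1 -> 0 < eps ->
  exists N, forall n, (N <= n)%N -> x ^+ n < eps.
Proof.
move=> x0 x1 e0; have h : `|x| < 1 by rewrite ger0_norm.
have /cvgr0Pnorm_lt/(_ _ e0)[N _ hN] := cvg_expr h.
by exists N => n hn; have := hN n hn; rewrite /= ger0_norm // exprn_ge0.
Qed.

Lemma series_comp_cvg (a : nat -> C) M B (G : R) V u v l :
  0 <= M -> 0 <= B -> 1 <= G -> G * (M * abs u) < 1 -> V 0%N = 0 ->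
  (forall i, abs (a i) <= B * G ^+ i) -> coef_le M V -> expands M V u v ->
  cvg_abs (@abs R Fq C) (partial_sum a v) l ->
  cvg_abs (@abs R Fq C) (partial_sum (series_comp a V) u) l.
Proof.
move=> M0 B0 G1 GMu V0 ha hV ev hl.
have Mu0 : 0 <= M * abs u by rewrite mulr_ge0 ?abs_ge0.
have G0 : 0 <= G by apply: le_trans G1.
have Mu1 : M * abs u <= 1.
  by rewrite (le_trans _ (ltW GMu)) // ler_peMl.
have hdiff N : abs (partial_sum (series_comp a V) u N - partial_sum a v N) <=
    B * (G * (M * abs u)) ^+ N.
  rewrite partial_sum_comp // absB -sumrB.
  have h0 : 0 <= B * (G * (M * abs u)) ^+ N.
    by rewrite mulr_ge0 // exprn_ge0 // mulr_ge0.
  apply: abs_sum_le => // i _; rewrite -mulrBr absM exprMn mulrA.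
  apply: ler_pM; rewrite ?abs_ge0 //; last exact: expandsX.
  rewrite (le_trans (ha i)) // ler_wpM2l // ler_weXn2l //.
  exact: ltnW.
have -> : partial_sum (series_comp a V) u = fun N =>
    (partial_sum (series_comp a V) u N - partial_sum a v N) + partial_sum a v N.
  by apply/funext => N; rewrite subrK.
rewrite -[l]add0r; apply: cvg_absD => //; apply/cvg_absP => eps e0.
have B1 : 0 < B + 1 by rewrite ltr_wpDl.
have [N hN] := expr_cvg0 (mulr_ge0 G0 Mu0) GMu (divr_gt0 e0 B1).
exists N => n /hN hn; rewrite subr0 (le_lt_trans (hdiff n)) //.
rewrite ltr_pdivlMr // mulrC in hn; apply: le_lt_trans hn.
by apply: ler_wpM2r; [rewrite exprn_ge0 // mulr_ge0|rewrite lerDl].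
Qed.

Lemma series_coef_bound (a : nat -> C) u l : u != 0 ->
  cvg_abs (@abs R Fq C) (partial_sum a u) l ->
  exists2 B, 0 <= B & forall i, abs (a i) <= B * (abs u)^-1 ^+ i.
Proof.
move=> u0 /cvg_absP/(_ _ ltr01)[N hN].
have u0' : 0 < abs u by rewrite abs_gt0.
pose B := 1 + \sum_(i < N) abs (a i * u ^+ i).
have hs : 0 <= \sum_(i < N) abs (a i * u ^+ i).
  by apply: sumr_ge0 => i _; exact: abs_ge0.
exists B => [|i]; first by rewrite addr_ge0.
suff : abs (a i * u ^+ i) <= B.
  by rewrite absM absX exprVn ler_pdivlMr // exprn_gt0.
have [iN|Ni] := ltnP i N.
  rewrite /B (bigD1 (Ordinal iN)) //= addrCA lerDl addr_ge0 //.
  by apply: sumr_ge0 => *; exact: abs_ge0.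
have -> : a i * u ^+ i = (partial_sum a u i.+1 - l) - (partial_sum a u i - l).
  by rewrite /partial_sum big_ord_recr /= opprB addrA subrK addrAC subrr add0r.
rewrite (@le_trans _ _ 1) ?lerDl //; apply: absB_le; apply/ltW/hN => //.
exact: leqW.
Qed.

End PowerSeries.

Section CuspExpansion.
Variables (R : realType) (Fq : finFieldType) (C : Cinf R Fq).
Implicit Types (c : ratfun Fq) (f g : OmegaFun C) (r : R).

Lemma inv_exp_scale_expands I (s : seq I) (P : pred I) (e : I -> C) M :
  1 <= M -> (forall i, P i -> e i != 0) -> (forall i, P i -> abs (e i) <= M) ->
  exists V : nat -> C, [/\ V 0%N = 0, coef_le M V &
    forall w, w != 0 -> M * abs w^-1 < 1 ->
      expands M V w^-1 (w * \prod_(i <- s | P i) (1 - w / e i))^-1].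
Proof.
move=> M1 he hM; have M0 : 0 <= M by apply: le_trans M1.
elim: s => [|i s [V [V0 hV ev]]].
  exists (fun n => (n == 1%N)%:R); split => // [|w w0 Mw].
    exact: coef_le_id.
  by rewrite big_nil mulr1; apply: expands_id => //; exact: ltW.
case Pi : (P i); last first.
  by exists V; split => // w w0 Mw; rewrite big_cons Pi; exact: ev.
pose W n := series1 C n - e i ^+ n.
have hW : coef_le M W.
  move=> n; apply: absB_le; first exact: coef_le1.
  by rewrite absX lerXn2r ?nnegrE ?abs_ge0 ?hM.
exists (series_mul W V); split => [||w w0 Mw].
- by rewrite /series_mul big_ord1 V0 mulr0.
- exact: coef_le_mul.
rewrite big_cons Pi mulrCA invfM.
apply: expandsM => //; [exact: ltW| |exact: ev].
have ei0 := he i Pi.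
have y1 : abs (e i * w^-1) < 1.
  by rewrite (le_lt_trans _ Mw) // absM ler_wpM2r ?abs_ge0 ?hM.
have y0 : 1 - e i * w^-1 != 0.
  by apply/eqP => /eqP; rewrite subr_eq0 => /eqP h; rewrite -h abs1 ltxx in y1.
have wei : w - e i != 0.
  apply: contraNneq y0 => /eqP; rewrite subr_eq0 => /eqP <-.
  by rewrite mulfV // subrr.
have -> : (1 - w / e i)^-1 = 1 - (1 - e i * w^-1)^-1.
  by field; rewrite w0 wei ei0 -opprB oppr_eq0 wei.
by apply: expandsB; [exact: expands1|apply: expands_geometric => //; exact: hM].
Qed.

Definition expandable c f := exists (a : nat -> C) (r : R), a 0%N = 0 /\
  forall z, imag_ge r z ->
    cvg_abs (@abs R Fq C) (partial_sum a (lattice_exp c (val z))^-1) (f z).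

Lemma expandableP f :
  vanishes_at_infty f <-> exists2 c, c != 0 & expandable c f.
Proof.
have E c (a : nat -> C) (z : Omega C) :
    (fun N => \sum_(i < N) a i * (lattice_exp c (val z)) ^- i) =
    partial_sum a (lattice_exp c (val z))^-1.
  by apply/funext => N; apply: eq_bigr => i _; rewrite exprVn.
split=> [[c [c0 [a [r [a0 h]]]]]|[c c0 [a [r [a0 h]]]]].
  by exists c => //; exists a, r; split=> // z /h; rewrite E.
by exists c; split=> //; exists a, r; split=> // z /h; rewrite E.
Qed.

Lemma imag_ge_le r r' (z : Omega C) : r <= r' -> imag_ge r' z -> imag_ge r z.
Proof. by move=> rr' h x /h; exact: le_trans. Qed.

Lemma expandable_scale c f (g : {poly Fq}) : c != 0 -> g != 0 ->
  expandable c f -> expandable (c * FracField.tofrac g) f.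
Proof.
move=> c0 g0 [a [r [a0 ha]]]; set c' := c * _.
have c'0 : c' != 0 := scale_lattice_neq0 c0 g0.
have sg : size g = (size g).-1.+1 by rewrite prednK // size_poly_gt0.
pose r1 := Num.max r 1; have r1_gt0 : 0 < r1 by rewrite lt_max ltr01 orbT.
have [[z0 hz0]|none] := pselect (exists z, @imag_ge R Fq C r1 z); last first.
  exists (fun=> 0), r1; split=> // z hz; case: none; by exists z.
pose u0 := (lattice_exp c (val z0))^-1.
have u0_neq0 : u0 != 0 by rewrite invr_eq0 (lattice_exp_neq0 c0 r1_gt0 hz0).
have hz0' : imag_ge r z0 by apply: imag_ge_le hz0; rewrite le_max lexx.
have [B B0 hB] := series_coef_bound u0_neq0 (ha _ hz0').
pose G := Num.max 1 (abs u0)^-1; have G1 : 1 <= G by rewrite le_max lexx.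
pose I := 'rV[Fq]_(size g).-1.
pose e (b : I) := lattice_exp c' (lattice_pt C c b).
pose M := 1 + \sum_(b : I) abs (e b).
have M1 : 1 <= M by rewrite lerDl sumr_ge0 // => b _; exact: abs_ge0.
have M0 : 0 <= M by apply: le_trans M1.
have hM b : abs (e b) <= M.
  rewrite /M (bigD1 b) //= addrCA lerDl addr_ge0 // sumr_ge0 // => i _.
  exact: abs_ge0.
have he (b : I) : b != 0 -> e b != 0.
  rewrite /e /c' => b0.
  have h := lattice_exp_pt_neq0 C c0 sg b0.
  exact: h.
have [V [V0 hV ev]] :=
  inv_exp_scale_expands (index_enum I) M1 he (fun b _ => hM b).
pose r2 := Num.max r1 (2 * (G * M)).
have GM0 : 0 < G * M by rewrite mulr_gt0 // (lt_le_trans ltr01).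
have r2_gt0 : 0 < r2 by rewrite lt_max r1_gt0.
exists (series_comp a V), r2; split.
  by rewrite /series_comp big_ord1 a0 mul0r.
move=> z hz; have hz1 : imag_ge r z.
  by apply: imag_ge_le hz; rewrite /r2 /r1 !le_max lexx.
have hw := lattice_exp_imag_ge c'0 r2_gt0 hz.
set w := lattice_exp c' (val z) in hw *.
have w_gt0 : 0 < abs w by exact: lt_le_trans hw.
have w0 : w != 0 by rewrite -abs_gt0.
have GMw : G * (M * abs w^-1) < 1.
  rewrite mulrA absV ltr_pdivrMr // mul1r (lt_le_trans _ hw) //.
  rewrite lt_max; apply/orP; right; lra.
have Mw : M * abs w^-1 < 1.
  by rewrite (le_lt_trans _ GMw) // ler_peMl // mulr_ge0 ?abs_ge0.
have := ha z hz1; rewrite (lattice_exp_scale (val z) c0 sg) -/c' -/w => hl.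
apply: (series_comp_cvg M0 B0 G1 GMw V0 _ hV (ev w w0 Mw) hl) => i.
rewrite (le_trans (hB i)) // ler_wpM2l // lerXn2r ?nnegrE ?invr_ge0 ?abs_ge0 //.
  exact: le_trans G1.
by rewrite le_max lexx orbT.
Qed.

Lemma expandableD c f g :
  expandable c f -> expandable c g -> expandable c (f + g).
Proof.
move=> [a [r [a0 ha]]] [b [s [b0 hb]]].
exists (fun n => a n + b n), (Num.max r s); split; first by rewrite a0 b0 addr0.
move=> z hz; rewrite (_ : partial_sum _ _ = fun N =>
    partial_sum a (lattice_exp c (val z))^-1 N +
    partial_sum b (lattice_exp c (val z))^-1 N).
  by apply: cvg_absD; [apply: ha|apply: hb];
     apply: imag_ge_le hz; rewrite le_max lexx ?orbT.
apply/funext => N; rewrite /partial_sum -big_split /=.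
by apply: eq_bigr => i _; rewrite mulrDl.
Qed.

Lemma ratfun_frac c : c != 0 -> exists x y : {poly Fq},
  [/\ x != 0, y != 0 & c = FracField.tofrac x / FracField.tofrac y].
Proof.
have [x [y [y0 ->]]] := frac_numden c; rewrite mulf_eq0 negb_or tofrac_eq0.
by case/andP => x0 _; exists x, y.
Qed.

Lemma vanishes_at_inftyD f g :
  vanishes_at_infty f -> vanishes_at_infty g -> vanishes_at_infty (f + g).
Proof.
move=> /expandableP[c c0 hf] /expandableP[d d0 hg]; apply/expandableP.
have [x [y [x0 y0 cE]]] := ratfun_frac c0.
have [x' [y' [x'0 y'0 dE]]] := ratfun_frac d0.
have yx'0 : y * x' != 0 by rewrite mulf_neq0.
have xy'0 : x * y' != 0 by rewrite mulf_neq0.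
exists (c * FracField.tofrac (y * x')); first exact: scale_lattice_neq0 c0 yx'0.
apply: expandableD; first exact: (expandable_scale c0 yx'0 hf).
have -> : c * FracField.tofrac (y * x') = d * FracField.tofrac (x * y').
  rewrite cE dE !tofracM mulrA divfK ?tofrac_eq0 //.
  by rewrite [RHS]mulrCA divfK ?tofrac_eq0.
exact: (expandable_scale d0 xy'0 hg).
Qed.

Lemma vanishes_at_inftyZ (x : C) f :
  vanishes_at_infty f -> vanishes_at_infty (x *: f).
Proof.
move=> /expandableP[c c0 [a [r [a0 ha]]]]; apply/expandableP; exists c => //.
exists (fun n => x * a n), r; split=> [|z /ha hz]; first by rewrite a0 mulr0.
rewrite (_ : partial_sum _ _ = fun N =>
    x * partial_sum a (lattice_exp c (val z))^-1 N); first exact: cvg_absZ.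
apply/funext => N; rewrite /partial_sum mulr_sumr.
by apply: eq_bigr => i _; rewrite mulrA.
Qed.

End CuspExpansion.

(** * The slash operator *)

Section TwoByTwo.
Variable K : comNzRingType.
Implicit Types g h : 'M[K]_2.

Lemma mul_mx22 g h i j : (g *m h) i j = g i 0 * h 0 j + g i 1 * h 1 j.
Proof.
rewrite mxE !big_ord_recl big_ord0 addr0 [lift _ _](_ : _ = 1) //.
exact: val_inj.
Qed.

Lemma det_mx22 g : \det g = g 0 0 * g 1 1 - g 0 1 * g 1 0.
Proof.
rewrite (expand_det_row _ 0) !big_ord_recl big_ord0 addr0.
rewrite /cofactor !det_mx11 !mxE /= !expr0 !mul1r expr1.
have -> : lift 0 (0 : 'I_1) = 1 :> 'I_2 by exact: val_inj.
have -> : lift 1 (0 : 'I_1) = 0 :> 'I_2 by exact: val_inj.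
by rewrite mulN1r mulrN.
Qed.

Lemma mx2E (a b c d : K) : [/\ mx2 a b c d 0 0 = a, mx2 a b c d 0 1 = b,
  mx2 a b c d 1 0 = c & mx2 a b c d 1 1 = d].
Proof. by rewrite !mxE. Qed.

Lemma eq_mx22 g h : g 0 0 = h 0 0 -> g 0 1 = h 0 1 -> g 1 0 = h 1 0 ->
  g 1 1 = h 1 1 -> g = h.
Proof.
move=> e00 e01 e10 e11; apply/matrixP => -[[|[|//]] ?] [[|[|//]] ?].
- by move: e00; congr (_ = _); congr fun_of_matrix; apply: val_inj.
- by move: e01; congr (_ = _); congr fun_of_matrix; apply: val_inj.
- by move: e10; congr (_ = _); congr fun_of_matrix; apply: val_inj.
- by move: e11; congr (_ = _); congr fun_of_matrix; apply: val_inj.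
Qed.

End TwoByTwo.

Section SlashOperator.
Variables (R : realType) (Fq : finFieldType) (C : Cinf R Fq).
Implicit Types (f : OmegaFun C) (g h : 'M[ratfun Fq]_2) (z : Omega C).
Local Notation inKm g := (map_mx (inK C) g).

Lemma Omega_notKinf z : ~ Kinf (val z).
Proof. by have := valP z; rewrite notin_setE. Qed.

Lemma det_inK_neq0 g : g \in unitmx ->
  inK C (g 0 0) * inK C (g 1 1) - inK C (g 0 1) * inK C (g 1 0) != 0.
Proof. by rewrite unitmxE unitfE det_mx22 -!rmorphM -rmorphB fmorph_eq0. Qed.

Lemma mobius_den_neq0 g z : g \in unitmx ->
  inK C (g 1 0) * val z + inK C (g 1 1) != 0.
Proof.
move=> /det_inK_neq0 dg; have [c0|c0] := eqVneq (inK C (g 1 0)) 0.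
  by apply: contraNneq dg; rewrite c0 mul0r add0r => ->; rewrite !mulr0 subrr.
apply/eqP => /eqP; rewrite addr_eq0 => /eqP e; apply: (@Omega_notKinf z).
rewrite -(mulKf c0 (val z)) e.
by apply: KinfM; [apply: KinfV|apply: KinfN]; exact: Kinf_inK.
Qed.

Lemma mobius_notKinf g z : g \in unitmx ->
  (inK C (g 0 0) * val z + inK C (g 0 1)) /
  (inK C (g 1 0) * val z + inK C (g 1 1)) \notin @Kinf R Fq C.
Proof.
move=> ug; have den := mobius_den_neq0 z ug; have dg := det_inK_neq0 ug.
rewrite notin_setE => /=; set y := _ / _ => Ky; apply: (@Omega_notKinf z).
have e : inK C (g 0 0) * val z + inK C (g 0 1) =
    y * (inK C (g 1 0) * val z + inK C (g 1 1)) by rewrite divfK.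
have e' : (inK C (g 1 0) * y - inK C (g 0 0)) * val z =
    inK C (g 0 1) - inK C (g 1 1) * y.
  apply/eqP; rewrite -subr_eq0; move/eqP: e; rewrite -subr_eq0 -oppr_eq0.
  by congr (_ == 0); ring.
have [h|h] := eqVneq (inK C (g 1 0) * y - inK C (g 0 0)) 0.
  move/eqP: dg; case; move/eqP: e'; rewrite h mul0r eq_sym subr_eq0 => /eqP ->.
  by move/eqP: h; rewrite subr_eq0 => /eqP <-; ring.
rewrite -(mulKf h (val z)) e'.
apply: KinfM; first apply: KinfV; apply: KinfD; try apply: KinfN;
  try apply: KinfM => //; exact: Kinf_inK.
Qed.

Lemma val_mobius g z : g \in unitmx -> val (mobius (inKm g) z) =
  (inK C (g 0 0) * val z + inK C (g 0 1)) /
  (inK C (g 1 0) * val z + inK C (g 1 1)).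
Proof. by move=> ug; rewrite /mobius !mxE val_insubd mobius_notKinf. Qed.

Lemma slashE k m f g z : slash k m f (inKm g) z =
  f (mobius (inKm g) z) * (inK C (\det g)) ^ m *
  (inK C (g 1 0) * val z + inK C (g 1 1)) ^- k.
Proof. by rewrite /slash det_map_mx !mxE. Qed.

Lemma inK_mul_mx22 g h i j : inK C ((g *m h) i j) =
  inK C (g i 0) * inK C (h 0 j) + inK C (g i 1) * inK C (h 1 j).
Proof. by rewrite mul_mx22 rmorphD; congr (_ + _); exact: rmorphM. Qed.

Lemma slash_mul k m f g h : g \in unitmx -> h \in unitmx ->
  slash k m (slash k m f (inKm g)) (inKm h) = slash k m f (inKm (g *m h)).
Proof.
move=> ug uh; apply/funext => z.
have ugh : g *m h \in unitmx by rewrite unitmx_mul ug.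
have dh := mobius_den_neq0 z uh; have dg := mobius_den_neq0 (mobius (inKm h) z) ug.
have cocycle : inK C ((g *m h) 1 0) * val z + inK C ((g *m h) 1 1) =
    (inK C (g 1 0) * val (mobius (inKm h) z) + inK C (g 1 1)) *
    (inK C (h 1 0) * val z + inK C (h 1 1)).
  by rewrite (val_mobius z uh) !inK_mul_mx22; field.
have mob : mobius (inKm g) (mobius (inKm h) z) = mobius (inKm (g *m h)) z.
  apply: val_inj; rewrite (val_mobius z ugh) cocycle (val_mobius _ ug).
  rewrite (val_mobius z uh) in dg *; rewrite !inK_mul_mx22.
  move: dg dh; move: (inK C (g 0 0)) (inK C (g 0 1)) (inK C (g 1 0)) (inK C (g 1 1)).
  move: (inK C (h 0 0)) (inK C (h 0 1)) (inK C (h 1 0)) (inK C (h 1 1)) (val z).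
  move=> h00 h01 h10 h11 w g00 g01 g10 g11.
  set D := h10 * w + h11; set N := h00 * w + h01 => dg dh.
  have -> : (g00 * h00 + g01 * h10) * w + (g00 * h01 + g01 * h11) =
    g00 * N + g01 * D by rewrite /N /D; ring.
  rewrite [g00 * N + _](_ : _ = (g00 * (N / D) + g01) * D); last by field.
  by rewrite invfM mulrACA mulfV // mulr1.
rewrite !slashE mob cocycle det_mulmx [inK C (\det g * _)]rmorphM.
rewrite expfzMl exprMn invfM.
by move: (_ ^ m) (_ ^ m) (_ ^+ k)^-1 (_ ^+ k)^-1 => A B D E; ring.
Qed.

End SlashOperator.

(** * Cusp forms and the trace *)

Section CuspForms.
Variables (R : realType) (Fq : finFieldType) (C : Cinf R Fq).
Variables (k : nat) (m : int).
Implicit Types (f : OmegaFun C) (g h : 'M[{poly Fq}]_2) (z : Omega C).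
Local Notation slash := (@slash R Fq C k m).
Local Notation inAm g := (map_mx (@inA R Fq C) g).

Lemma rigid_analyticD (f1 f2 : OmegaFun C) :
  rigid_analytic f1 -> rigid_analytic f2 -> rigid_analytic (f1 + f2).
Proof.
move=> h1 h2 N eps e0.
have [P1 [Q1 H1]] := h1 N eps e0; have [P2 [Q2 H2]] := h2 N eps e0.
exists (P1 * Q2 + P2 * Q1), (Q1 * Q2) => z hz.
have [q1 a1] := H1 z hz; have [q2 a2] := H2 z hz.
rewrite hornerM mulf_neq0 //; split=> //.
rewrite (_ : _ - _ = (f1 z - P1.[val z] / Q1.[val z]) +
                     (f2 z - P2.[val z] / Q2.[val z])).
  exact: absD_lt.
rewrite -[(f1 + f2) z]/(f1 z + f2 z : C) hornerD !hornerM.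
by field; rewrite q1 q2.
Qed.

Lemma rigid_analyticZ (x : C) f : rigid_analytic f -> rigid_analytic (x *: f).
Proof.
move=> hf N eps e0; have x1 : 0 < abs x + 1 by rewrite ltr_wpDl ?abs_ge0.
have [P [Q H]] := hf N _ (divr_gt0 e0 x1); exists (x *: P), Q => z hz.
have [q a] := H z hz; split=> //.
rewrite -[(x *: f) z]/(x * f z : C) hornerZ -mulrA -mulrBr absM.
rewrite ltr_pdivlMr // mulrC in a; apply: le_lt_trans a.
by rewrite ler_wpM2r ?abs_ge0 // lerDl.
Qed.

Lemma slashD (f1 f2 : OmegaFun C) M : slash (f1 + f2) M = slash f1 M + slash f2 M.
Proof.
apply/funext => z; rewrite /Defs.slash.
by rewrite -[RHS]/(_ + _ : C) -[(f1 + f2) _]/(f1 _ + f2 _ : C) !mulrDl.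
Qed.

Lemma slashZ (x : C) f M : slash (x *: f) M = x *: slash f M.
Proof.
apply/funext => z; rewrite /Defs.slash.
by rewrite -[RHS]/(x * _ : C) -[(x *: f) _]/(x * f _ : C) !mulrA.
Qed.

Lemma slash0 M : slash 0 M = 0.
Proof. by rewrite -(scale0r (0 : OmegaFun C)) slashZ !scale0r. Qed.

Lemma slash_sum I (s : seq I) (P : pred I) (F : I -> OmegaFun C) M :
  slash (\sum_(i <- s | P i) F i) M = \sum_(i <- s | P i) slash (F i) M.
Proof.
by apply: (big_morph (fun f => slash f M)) => [f1 f2|]; rewrite ?slashD ?slash0.
Qed.

Lemma cusp_formsD G (f1 f2 : OmegaFun C) :
  cusp_forms k m G f1 -> cusp_forms k m G f2 -> cusp_forms k m G (f1 + f2).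
Proof.
move=> [a1 b1 c1] [a2 b2 c2]; split=> [|g Gg|g ug].
- exact: rigid_analyticD.
- by rewrite slashD b1 // b2.
by rewrite slashD; apply: vanishes_at_inftyD; [exact: c1|exact: c2].
Qed.

Lemma cusp_formsZ G (x : C) f : cusp_forms k m G f -> cusp_forms k m G (x *: f).
Proof.
move=> [a b c]; split=> [|g Gg|g ug].
- exact: rigid_analyticZ.
- by rewrite slashZ b.
by rewrite slashZ; apply: vanishes_at_inftyZ; exact: c.
Qed.

Lemma cusp_forms_subset (G H : set 'M[{poly Fq}]_2) : G `<=` H ->
  @cusp_forms R Fq C k m H `<=` cusp_forms k m G.
Proof. by move=> GH f [a b c]; split=> // g /GH; exact: b. Qed.

Lemma Gamma0t_sub_GL2A : @Gamma0t Fq `<=` @GL2A Fq.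
Proof. by move=> g []. Qed.

Lemma inAmE g : inAm g = map_mx (inK C) (map_mx (@FracField.tofrac _) g).
Proof. by apply/matrixP => i j; rewrite !mxE. Qed.

Lemma tofrac_unitmx g :
  g \in unitmx -> map_mx (@FracField.tofrac {poly Fq}) g \in unitmx.
Proof. by rewrite !unitmxE det_map_mx; exact: rmorph_unit. Qed.

Lemma slash_inA_mul f g h : g \in unitmx -> h \in unitmx ->
  slash (slash f (inAm g)) (inAm h) = slash f (inAm (g *m h)).
Proof.
by move=> ug uh; rewrite !inAmE slash_mul ?tofrac_unitmx // -map_mxM.
Qed.

(* Representatives of Gamma_0(t) \ GL_2(F_q[t]), indexed by P^1(F_q). *)
Definition coset_rep (x : option Fq) : 'M[{poly Fq}]_2 :=
  if x is Some b then mx2 0 (-1) 1 b%:P else 1%:M.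

Definition coset_class g : option Fq :=
  if (g 1 0).[0] == 0 then None else Some ((g 1 1).[0] / (g 1 0).[0]).

Lemma coset_rep_unit x : coset_rep x \in unitmx.
Proof.
case: x => [b|]; last exact: unitmx1.
rewrite unitmxE det_mx22; have [-> -> -> ->] := mx2E 0 (-1) 1 b%:P.
by rewrite mul0r sub0r mulN1r opprK unitr1.
Qed.

Lemma trace_coset_rep f :
  trace k m f = \sum_(x : option Fq) slash f (inAm (coset_rep x)).
Proof.
rewrite /trace (bigD1 None) //=; congr (_ + _).
  by congr (Defs.slash _ _ _ _); rewrite map_mx1.
rewrite (reindex_omap Some id) /=; last by case.
apply: eq_big => [b|b _]; first by rewrite eqxx.
congr (Defs.slash _ _ _ _); apply: eq_mx22; rewrite !mxE /= ?rmorph0 ?rmorph1 //.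
by rewrite rmorphN1.
Qed.

Lemma mulX_dvd (p : {poly Fq}) : ('X %| p) = (p.[0] == 0).
Proof. by rewrite -['X]subr0 -(rmorph0 (@polyC Fq)) dvdp_XsubCl. Qed.

Lemma coset_classP g : g \in unitmx ->
  exists2 d, Gamma0t d & g = d *m coset_rep (coset_class g).
Proof.
move=> ug; set r := coset_rep _.
exists (g *m invmx r); last by rewrite mulmxKV // coset_rep_unit.
split; first by rewrite unitmx_mul ug unitmx_inv coset_rep_unit.
rewrite mulX_dvd /r /coset_class; have [c0|c0] := eqVneq (g 1 0).[0] 0.
  by rewrite /= invmx1 mulmx1 c0.
set b := _ / _; have -> : invmx (coset_rep (Some b)) = mx2 b%:P 1 (-1) 0.
  have h : coset_rep (Some b) *m mx2 b%:P 1 (-1) 0 = 1%:M.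
    by apply: eq_mx22; rewrite !mul_mx22 !mxE /=; ring.
  by rewrite -[RHS](mulKmx (coset_rep_unit (Some b))) h mulmx1.
rewrite mul_mx22 !mxE /= mulrN1 hornerD hornerN hornerM hornerC.
by rewrite mulrCA mulfV // mulr1 subrr.
Qed.

Lemma slash_coset_class f g : cusp_forms k m (@Gamma0t Fq) f -> g \in unitmx ->
  slash f (inAm g) = slash f (inAm (coset_rep (coset_class g))).
Proof.
move=> [_ inv _] ug; have [d Gd e] := coset_classP ug.
by rewrite {1}e -(slash_inA_mul _ (proj1 Gd) (coset_rep_unit _)) (inv _ Gd).
Qed.

Lemma coset_class_inj g : g \in unitmx ->
  injective (fun x => coset_class (coset_rep x *m g)).
Proof.
move=> ug.
pose dg := (g 0 0).[0] * (g 1 1).[0] - (g 0 1).[0] * (g 1 0).[0].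
have dg0 : dg != 0.
  move: ug; rewrite unitmxE det_mx22 => /(rmorph_unit (horner_eval (0 : Fq))).
  by rewrite unitfE /= /horner_eval hornerD hornerN !hornerM.
have eval x i : ((coset_rep x *m g) 1 i).[0] =
    if x is Some b then (g 0 i).[0] + b * (g 1 i).[0] else (g 1 i).[0].
  rewrite mul_mx22; case: x => [b|] /=; rewrite !mxE /=.
    by rewrite mul1r hornerD hornerM hornerC.
  by rewrite mul0r mul1r add0r.
have cross x y : coset_class (coset_rep x *m g) = coset_class (coset_rep y *m g) ->
    ((coset_rep x *m g) 1 0).[0] * ((coset_rep y *m g) 1 1).[0] =
    ((coset_rep y *m g) 1 0).[0] * ((coset_rep x *m g) 1 1).[0].
  rewrite /coset_class; case: eqP => [->|/eqP x0]; case: eqP => [->|/eqP y0] //.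
    by rewrite !mul0r.
  move=> [] /(congr1 (fun u => u * ((coset_rep x *m g) 1 0).[0] *
                                   ((coset_rep y *m g) 1 0).[0])).
  by rewrite divfK // mulrAC divfK // => e; rewrite mulrC -e mulrC.
move=> x y /cross; rewrite !eval; case: x => [b|]; case: y => [b'|] // e.
- congr Some; apply/eqP; rewrite -subr_eq0.
  have : (b' - b) * dg == 0.
    by move/eqP: e; rewrite -subr_eq0; congr (_ == 0); rewrite /dg; ring.
  by rewrite mulf_eq0 (negPf dg0) orbF -opprB oppr_eq0.
- case/eqP: dg0; move/eqP: e; rewrite -subr_eq0 => /eqP <-; rewrite /dg; ring.
case/eqP: dg0; move/esym/eqP: e; rewrite -subr_eq0 => /eqP <-; rewrite /dg; ring.
Qed.

Lemma trace_GL2A f : cusp_forms k m (@Gamma0t Fq) f ->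
  cusp_forms k m (@Gamma0t Fq) (trace k m f) ->
  cusp_forms k m (@GL2A Fq) (trace k m f).
Proof.
move=> hf [a _ c]; split=> // g ug; rewrite trace_coset_rep slash_sum.
rewrite [RHS](reindex_inj (coset_class_inj ug)) /=; apply: eq_bigr => x _.
rewrite slash_inA_mul ?coset_rep_unit // slash_coset_class //.
by rewrite unitmx_mul coset_rep_unit.
Qed.

Lemma natr_card (F : finFieldType) : #|F|%:R = 0 :> F.
Proof.
have -> : #|F|%:R = \sum_(x : F) 1 :> F by rewrite sumr_const.
apply: (addrI (\sum_(x : F) x)); rewrite addr0 -big_split /=.
by rewrite [RHS](reindex_inj (addIr 1)).
Qed.

Lemma trace_id f : cusp_forms k m (@GL2A Fq) f -> trace k m f = f.
Proof.
move=> [_ inv _]; rewrite trace_coset_rep.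
rewrite (eq_bigr (fun=> f)) => [|x _]; last exact/inv/coset_rep_unit.
rewrite sumr_const card_option mulrS.
have q0 : #|Fq|%:R = 0 :> C.
  rewrite -(rmorph_nat (@inA R Fq C)) -(rmorph_nat (@polyC Fq)) natr_card.
  by rewrite !rmorph0.
have -> : f *+ #|Fq| = 0 by rewrite -scaler_nat q0 scale0r.
by rewrite addr0.
Qed.

Lemma fricke_GL2A f : cusp_forms k m (@GL2A Fq) f -> fricke k m f = delta_t m f.
Proof.
move=> [_ inv _].
pose S : 'M[{poly Fq}]_2 := mx2 0 (-1) 1 0.
pose X : ratfun Fq := FracField.tofrac 'X.
have X0 : X != 0 by rewrite tofrac_eq0 polyX_eq0.
pose D : 'M[ratfun Fq]_2 := mx2 X 0 0 1.
have uS : S \in unitmx by have := coset_rep_unit (Some 0); rewrite /= rmorph0.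
have uD : D \in unitmx.
  by rewrite unitmxE det_mx22 !mxE /= mulr1 mulr0 subr0 unitfE.
have -> : fricke k m f =
    slash f (map_mx (inK C) (map_mx (@FracField.tofrac _) S *m D)).
  congr (Defs.slash _ _ _ _); apply: eq_mx22;
    rewrite mxE [map_mx _ _ _ _]mxE mul_mx22 !mxE /=
      ?(mulr0, mul0r, mulr1, mul1r, addr0, add0r, rmorph0, rmorph1, rmorphN1) //.
rewrite -slash_mul ?tofrac_unitmx // -inAmE inv //.
apply/funext => z; rewrite slashE det_mx22 !mxE /= mulr1 mulr0 subr0.
rewrite rmorph0 rmorph1 mul0r add0r expr1n invr1 mulr1 mulrC; congr (_ * f _).
by rewrite /mobius !mxE /= rmorph0 rmorph1 mul0r add0r addr0 divr1.
Qed.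

End CuspForms.

(** * Matrices *)

Section LinearAlgebra.
Variables (K : fieldType) (n : nat).
Implicit Types (T F A : 'M[K]_n) (u v w x a b : 'cV[K]_n) (c : K).

Lemma unitmx_cV_inj A : (forall v, A *m v = 0 -> v = 0) -> A \in unitmx.
Proof.
move=> h; rewrite -unitmx_tr -row_free_unit; apply: inj_row_free => v.
move=> /(congr1 trmx); rewrite trmx_mul trmxK trmx0 => /h /(congr1 trmx).
by rewrite trmxK trmx0.
Qed.

Lemma old_new_decomposition T F c : c != 0 ->
  T *m T = T -> F *m F = c%:M ->
  (forall v, T *m v = v -> T *m (F *m v) = F *m v -> v = 0) ->
  ((forall v, exists a b x : 'cV[K]_n, [/\ T *m a = a, T *m b = b,
       T *m x = 0 /\ T *m (F *m x) = 0 & v = a + F *m b + x]) /\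
   (forall a b, T *m a = a -> T *m b = b -> T *m (a + F *m b) = 0 ->
       T *m (F *m (a + F *m b)) = 0 -> a + F *m b = 0)) <->
  1%:M - c^-1 *: ((T *m F) *m (T *m F)) \in unitmx.
Proof.
move=> c0 TT FF inj; set N := 1%:M - _.
have TK v : T *m (T *m v) = T *m v by rewrite mulmxA TT.
have FK v : F *m (F *m v) = c *: v by rewrite mulmxA FF mul_scalar_mx.
have NE v : N *m v = v - c^-1 *: (T *m (F *m (T *m (F *m v)))).
  by rewrite /N mulmxBl mul1mx -scalemxAl -!mulmxA.
split=> [[_ cap]|uN].
  apply: unitmx_cV_inj => v; rewrite NE => /eqP; rewrite subr_eq0 => /eqP ve.
  have Tv : T *m v = v by rewrite ve -scalemxAr TK.
  pose b := - (c^-1 *: (T *m (F *m v))).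
  have Tb : T *m b = b by rewrite /b mulmxN -scalemxAr TK.
  have TFb : T *m (F *m b) = - v by rewrite /b !mulmxN -!scalemxAr -ve.
  have cb : c *: b = - (T *m (F *m v)) by rewrite scalerN scalerA mulfV // scale1r.
  have := cap v b Tv Tb; rewrite !mulmxDr Tv TFb subrr FK -scalemxAr Tb cb subrr.
  move=> /(_ erefl erefl) /eqP; rewrite addr_eq0 => /eqP vF.
  apply: inj => //; have Fv : F *m v = - (c *: b) by rewrite vF mulmxN FK.
  by rewrite Fv mulmxN -scalemxAr Tb.
have Ninj v : N *m v = 0 -> v = 0.
  by move=> h; rewrite -(mulKmx uN v) h mulmx0.
have NT v : T *m (N *m v) = N *m v -> T *m v = v.
  move=> h; have -> : v = N *m v + c^-1 *: (T *m (F *m (T *m (F *m v)))).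
    by rewrite NE subrK.
  by rewrite mulmxDr h -scalemxAr TK.
split=> [v|a b Ta Tb].
  pose r := T *m v - c^-1 *: (T *m (F *m (T *m (F *m v)))).
  pose a := invmx N *m r.
  have Na : N *m a = r by rewrite /a mulKVmx.
  have Ta : T *m a = a.
    by apply: NT; rewrite Na /r mulmxBr -scalemxAr !TK.
  pose b := c^-1 *: (T *m (F *m (v - a))).
  have Tb : T *m b = b by rewrite /b -scalemxAr TK.
  have cb : c *: b = T *m (F *m (v - a)) by rewrite scalerA mulfV // scale1r.
  exists a, b, (v - (a + F *m b)); split=> //; last by rewrite addrC subrK.
  split.
    rewrite mulmxBr mulmxDr Ta /b -!scalemxAr !mulmxBr scalerBr.
    move: Na; rewrite NE /r => Na.
    rewrite -[X in _ - (X + _)](subrK (c^-1 *: (T *m (F *m (T *m (F *m a)))))).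
    by rewrite Na -addrA [_ + (_ - _)]addrC !subrK subrr.
  rewrite opprD addrA mulmxBr mulmxBr FK.
  by rewrite -[T *m (c *: b)]scalemxAr Tb cb subrr.
rewrite mulmxDr Ta => /eqP; rewrite addr_eq0 => /eqP ae.
rewrite !mulmxDr FK -scalemxAr Tb => /eqP; rewrite addrC addr_eq0 => /eqP be.
have a0 : a = 0.
  apply: Ninj; rewrite NE {1}ae.
  have -> : T *m (F *m a) = - (c *: b) by rewrite be opprK.
  by rewrite !mulmxN scalerN opprK -!scalemxAr scalerA mulVf // scale1r addNr.
have b0 : b = 0.
  move: be; rewrite a0 !mulmx0 oppr0 => /eqP.
  by rewrite scaler_eq0 (negPf c0) => /eqP.
by rewrite a0 b0 mulmx0 addr0.
Qed.

End LinearAlgebra.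

Section TraceFrickeMatrices.
Variables (R : realType) (Fq : finFieldType) (C : Cinf R Fq).
Variables (n j : nat).
Local Notation q := #|Fq|.
Local Notation T := (T_mx C n j).
Local Notation F := (F_mx C n j).

Lemma signr_card : (-1) ^+ q.-1 = 1 :> C.
Proof.
have h : (-1) ^+ q.-1 = 1 :> Fq.
  have N1 : -1 != 0 :> Fq by rewrite oppr_eq0 oner_eq0.
  apply: (mulfI N1); rewrite -exprS prednK ?mulr1 ?expf_card //.
  by rewrite ltnW // card_ge2.
have := congr1 (fun b : Fq => inA C b%:P) h.
by rewrite /= !(rmorphXn, rmorphN1, rmorph1).
Qed.

Lemma antidiag_eq (a b : 'I_n) : (a.+1 == n.+1 - b.+1)%N = (a == rev_ord b).
Proof. by rewrite -val_eqE /= subSS; have := ltn_ord b; have := ltn_ord a; lia. Qed.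

Lemma T_mxE (a b : 'I_n) : T a b =
  (a == b)%:R + M_entry C n j a.+1 (n - b) * (-1) ^+ j.+1.
Proof.
rewrite !mxE; congr (_ + _); rewrite (bigD1 (rev_ord b)) //= big1 => [|i ib].
  by rewrite !mxE antidiag_eq eqxx addr0 /= subnSK.
by rewrite !mxE antidiag_eq (negPf ib) mulr0.
Qed.

Lemma T_mx_eq0 (a b : 'I_n) : (b <= a)%N -> (n <= a + b.+1)%N -> T a b = 0.
Proof.
move=> ba nab; have q1 : (0 < q.-1)%N by have := card_ge2 Fq; lia.
have han := ltn_ord a; have hbn := ltn_ord b.
have binS x y : (x < y)%N -> 'C(j + x * q.-1, j + y * q.-1) = 0%N.
  by move=> xy; rewrite bin_small // ltn_add2l ltn_pmul2r.
rewrite T_mxE /M_entry; case: ifP => /eqP e.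
  rewrite -val_eqE /= (_ : (n - a.+1)%N = b); last by lia.
  have [<-|ab] := eqVneq (b : nat) a.
    by rewrite binn mulr1 -exprD addnS exprS -signr_odd oddD addbb mulr1 subrr.
  by rewrite binS ?mulr0 ?mul0r ?addr0 //=; rewrite ltn_neqAle ab.
rewrite (_ : (n - (n - b))%N = b); last by lia.
rewrite (binS (n - a.+1)%N b); last by lia.
rewrite -val_eqE /=; have [ab|ab] := eqVneq (a : nat) b.
  rewrite (_ : (n - b).-1 = (n - a.+1)%N); last by lia.
  by rewrite binn mulr1 add0r mulNr -exprD -signr_odd oddD addbb subrr.
rewrite binS ?mulr0 ?addr0 ?oppr0 ?mul0r ?addr0 //; lia.
Qed.

Lemma mul_F_mx (v : 'cV[C]_n) (a : 'I_n) :
  (F *m v) a 0 = (- tC C) ^+ s_exp Fq j (n - a) * v (rev_ord a) 0.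
Proof.
rewrite mxE (bigD1 (rev_ord a)) //= big1 => [|i ia].
  by rewrite mxE antidiag_eq rev_ordK eqxx addr0 /= subnSK.
rewrite mxE antidiag_eq (_ : (a == rev_ord i) = false) ?mul0r //.
by apply: contraNF ia => /eqP ->; rewrite rev_ordK.
Qed.

Lemma tC_neq0 : tC C != 0.
Proof. by rewrite inA_eq0 polyX_eq0. Qed.

Lemma F_mx_sq k : (1 <= n)%N -> k = (2 * j + 2 + (n - 1) * (q - 1))%N ->
  F *m F = (tC C ^+ k)%:M.
Proof.
move=> n0 ->; apply/trmx_inj/row_matrixP => b.
apply/rowP => a; rewrite !mxE.
have -> : \sum_i F a i * F i b = (F *m col b F) a 0.
  by rewrite mxE; apply: eq_bigr => i _; rewrite !mxE.
rewrite mul_F_mx !mxE antidiag_eq (inj_eq rev_ord_inj).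
have [->|ab] := eqVneq a b; last by rewrite mulr0 mulr0n.
rewrite mulr1n -exprD /s_exp.
set e := (_ + _)%N; have -> : e = (2 * j.+1 + (n - 1) * q.-1)%N.
  have hb := ltn_ord b; have -> : (n - 1)%N = ((n - b).-1 + b)%N by lia.
  rewrite /e mulnDl /=; lia.
have sg : (-1) ^+ (2 * j.+1 + (n - 1) * q.-1) = 1 :> C.
  by rewrite exprD [((n - 1) * _)%N]mulnC !exprM signr_card sqrrN !expr1n mulr1.
rewrite exprNn sg mul1r; congr (_ ^+ _).
by rewrite mulnS addnC [(2 + _)%N]addnC subn1 addnC; congr (_ + _ * _)%N; lia.
Qed.

(* T maps the vectors supported on l <= i < n - l to vectors vanishing at
   n - 1 - l, and F exchanges the coordinates i and n - 1 - i. *)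
Lemma T_F_fixed_eq0 (v : 'cV[C]_n) :
  T *m v = v -> T *m (F *m v) = F *m v -> v = 0.
Proof.
move=> Tv TFv; pose w := F *m v.
have w0 (a : 'I_n) : (w a 0 == 0) = (v (rev_ord a) 0 == 0).
  by rewrite mul_F_mx mulf_eq0 expf_eq0 oppr_eq0 (negPf tC_neq0) andbF.
have step (u : 'cV[C]_n) (l : 'I_n) : T *m u = u ->
    (forall i : 'I_n, (i < l)%N -> u i 0 = 0 /\ u (rev_ord i) 0 = 0) ->
    u (rev_ord l) 0 = 0.
  move=> Tu hu; rewrite -Tu mxE big1 // => b _.
  have [bl|lb] := ltnP b l; first by rewrite (proj1 (hu b bl)) mulr0.
  have hl := ltn_ord l; have hb := ltn_ord b.
  have [ab|ba] := ltnP (rev_ord l) b.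
    have bl : (rev_ord b < l)%N by rewrite /= in ab *; lia.
    by have [_] := hu _ bl; rewrite rev_ordK => ->; rewrite mulr0.
  by rewrite T_mx_eq0 ?mul0r //=; lia.
suff H : forall l (i : 'I_n), (i < l)%N -> v i 0 = 0 /\ v (rev_ord i) 0 = 0.
  by apply/colP => i; rewrite mxE; have [] := H n i (ltn_ord i).
elim=> [//|l IH] i; rewrite ltnS leq_eqVlt => /orP[/eqP il|]; last exact: IH.
have IHi (i' : 'I_n) : (i' < i)%N -> v i' 0 = 0 /\ v (rev_ord i') 0 = 0.
  by rewrite il; exact: IH.
split; last exact: step.
have IHw (i' : 'I_n) : (i' < i)%N -> w i' 0 = 0 /\ w (rev_ord i') 0 = 0.
  by move=> /IHi [h1 h2]; split; apply/eqP; rewrite w0 ?rev_ordK ?h1 ?h2.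
by apply/eqP; rewrite -[i]rev_ordK -w0; apply/eqP; exact: step.
Qed.

End TraceFrickeMatrices.

(** * Coordinates in the basis *)

Section Coordinates.
Variables (R : realType) (Fq : finFieldType) (C : Cinf R Fq).
Variables (k n : nat) (m : int) (e : 'I_n -> OmegaFun C).
Implicit Types (x y : 'cV[C]_n).

Definition lincomb x : OmegaFun C := \sum_i x i 0 *: e i.

Lemma lincombD x y : lincomb (x + y) = lincomb x + lincomb y.
Proof. by rewrite -big_split /=; apply: eq_bigr => i _; rewrite mxE scalerDl. Qed.

Lemma lincombZ (c : C) x : lincomb (c *: x) = c *: lincomb x.
Proof.
by rewrite /lincomb scaler_sumr; apply: eq_bigr => i _; rewrite mxE scalerA.
Qed.

Lemma lincomb0 : lincomb 0 = 0.
Proof. by rewrite -(scale0r (0 : 'cV_n)) lincombZ scale0r. Qed.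

Lemma lincomb_matrix (L : OmegaFun C -> OmegaFun C) P x :
  (forall f g, L (f + g) = L f + L g) -> (forall c f, L (c *: f) = c *: L f) ->
  is_matrix_of e L P -> L (lincomb x) = lincomb (P *m x).
Proof.
move=> LD LZ LP.
have L0 : L 0 = 0 by rewrite -(scale0r (0 : OmegaFun C)) LZ !scale0r.
rewrite /lincomb (big_morph L LD L0).
under eq_bigr do rewrite LZ LP scaler_sumr.
rewrite exchange_big /=; apply: eq_bigr => a _; rewrite mxE scaler_suml.
by apply: eq_bigr => b _; rewrite scalerA mulrC.
Qed.

Lemma frickeD (f g : OmegaFun C) :
  fricke k m (f + g) = fricke k m f + fricke k m g.
Proof. exact: slashD. Qed.

Lemma frickeZ (c : C) (f : OmegaFun C) : fricke k m (c *: f) = c *: fricke k m f.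
Proof. exact: slashZ. Qed.

Lemma traceD (f g : OmegaFun C) :
  trace k m (f + g) = trace k m f + trace k m g.
Proof.
rewrite !trace_coset_rep -big_split /=.
by apply: eq_bigr => b _; rewrite slashD.
Qed.

Lemma traceZ (c : C) (f : OmegaFun C) : trace k m (c *: f) = c *: trace k m f.
Proof.
rewrite !trace_coset_rep scaler_sumr.
by apply: eq_bigr => b _; rewrite slashZ.
Qed.

Section Basis.
Hypothesis n_gt0 : (0 < n)%N.
Hypothesis he : is_basis (cusp_forms k m (@Gamma0t Fq)) e.

Lemma lincomb_cusp x : cusp_forms k m (@Gamma0t Fq) (lincomb x).
Proof.
apply: (big_ind (cusp_forms k m (@Gamma0t Fq))) => [|f g|i _].
- by rewrite -(scale0r (e (Ordinal n_gt0))); apply: cusp_formsZ; exact: he.1.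
- exact: cusp_formsD.
by apply: cusp_formsZ; exact: he.1.
Qed.

Lemma lincomb_inj : injective lincomb.
Proof.
move=> x y xy; have [z [_ uz]] := he.2 _ (lincomb_cusp x).
by rewrite -(uz x erefl) -(uz y xy).
Qed.

Lemma lincomb_surj f : cusp_forms k m (@Gamma0t Fq) f -> exists x, f = lincomb x.
Proof. by move=> /he.2 [x [-> _]]; exists x. Qed.

Lemma trace_fixed_GL2A x T : is_matrix_of e (trace k m) T ->
  cusp_forms k m (@GL2A Fq) (lincomb x) <-> T *m x = x.
Proof.
move=> hT; have TE := lincomb_matrix x traceD traceZ hT; split.
  by move=> /trace_id; rewrite TE => /lincomb_inj.
move=> Tx; rewrite -{1}Tx -TE; apply: trace_GL2A; first exact: lincomb_cusp.
by rewrite TE; exact: lincomb_cusp.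
Qed.

Lemma trace_matrix_idem T : is_matrix_of e (trace k m) T -> T *m T = T.
Proof.
move=> hT; have TE x := lincomb_matrix x traceD traceZ hT.
suff h (x : 'cV_n) : T *m (T *m x) = T *m x.
  apply/matrixP => a b; have := h (delta_mx b 0).
  by rewrite mulmxA -!colE => /colP/(_ a); rewrite [LHS]mxE [RHS]mxE.
apply/(trace_fixed_GL2A _ hT); rewrite -TE; apply: trace_GL2A.
  exact: lincomb_cusp.
by rewrite TE; exact: lincomb_cusp.
Qed.

Lemma oldforms_lincomb T F (tau : C) f : tau != 0 ->
  is_matrix_of e (trace k m) T -> is_matrix_of e (fricke k m) (tau *: F) ->
  oldforms k m f <-> exists a b : 'cV_n,
    [/\ T *m a = a, T *m b = b & f = lincomb (a + F *m b)].
Proof.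
move=> tau0 hT hF; have FE x := lincomb_matrix x frickeD frickeZ hF.
split=> [[f1 h1 [f2 h2 <-]]|[a [b [Ta Tb ->]]]].
  have [a ae] := lincomb_surj (cusp_forms_subset (@Gamma0t_sub_GL2A Fq) h1).
  have [b be] := lincomb_surj (cusp_forms_subset (@Gamma0t_sub_GL2A Fq) h2).
  rewrite -(fricke_GL2A h2) be FE /delta_1 ae -lincombD.
  exists a, (tau *: b); rewrite ae in h1; rewrite be in h2.
  split; first exact/(trace_fixed_GL2A _ hT).
    by rewrite -scalemxAr; congr (_ *: _); exact/(trace_fixed_GL2A _ hT).
  by rewrite -scalemxAl scalemxAr.
have h2 : cusp_forms k m (@GL2A Fq) (lincomb (tau^-1 *: b)).
  by apply/(trace_fixed_GL2A _ hT); rewrite -scalemxAr Tb.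
exists (lincomb a); first exact/(trace_fixed_GL2A _ hT).
exists (lincomb (tau^-1 *: b)) => //.
rewrite -(fricke_GL2A h2) FE /delta_1 -lincombD.
by rewrite -scalemxAl -scalemxAr scalerA mulfV // scale1r.
Qed.

Lemma newforms_lincomb T F (tau : C) x : tau != 0 ->
  is_matrix_of e (trace k m) T -> is_matrix_of e (fricke k m) (tau *: F) ->
  newforms k m (lincomb x) <-> T *m x = 0 /\ T *m (F *m x) = 0.
Proof.
move=> tau0 hT hF; have FE y := lincomb_matrix y frickeD frickeZ hF.
have TE y := lincomb_matrix y traceD traceZ hT.
have t'E : trace' k m (lincomb x) = lincomb (tau *: (T *m (F *m x))).
  by rewrite /trace' FE TE -scalemxAl -scalemxAr.
split=> [[_]|[Tx TFx]]; last first.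
  split; first exact: lincomb_cusp.
    by rewrite TE Tx lincomb0.
  by rewrite t'E TFx scaler0 lincomb0.
rewrite TE t'E -{1}lincomb0 => /lincomb_inj ->.
rewrite -lincomb0 => /lincomb_inj /eqP.
by rewrite scaler_eq0 (negPf tau0) => /eqP ->.
Qed.

End Basis.
End Coordinates.

Theorem theorem5p1 (R : realType) (Fq : finFieldType) (C : Cinf R Fq)
  (j n k : nat) (m : int)
  (hj : (j <= #|Fq| - 2)%N) (hn : (1 <= n)%N)
  (hk : k = (2 * j + 2 + (n - 1) * (#|Fq| - 1))%N)
  (hm : (m == j.+1 %[mod (#|Fq| - 1)%N])%Z)
  (e : 'I_n -> OmegaFun C)
  (he : is_basis (cusp_forms k m (@Gamma0t Fq)) e)
  (hTr : is_matrix_of e (trace k m) (T_mx C n j))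
  (hFr : is_matrix_of e (fricke k m) (tC C ^ (m - k%:Z) *: F_mx C n j)) :
  direct_sum (cusp_forms k m (@Gamma0t Fq)) (@oldforms _ _ C k m)
    (@newforms _ _ C k m)
  <-> 1%:M - tC C ^- k *: ((T_mx C n j *m F_mx C n j) *m
                           (T_mx C n j *m F_mx C n j)) \in unitmx.
Proof.
have tau0 : tC C ^ (m - k%:Z) != 0 by rewrite expfz_neq0 // tC_neq0.
have tk0 : tC C ^+ k != 0 by rewrite expf_neq0 // tC_neq0.
have oldE f := oldforms_lincomb hn he f tau0 hTr hFr.
have newE x := newforms_lincomb hn he x tau0 hTr hFr.
rewrite -(old_new_decomposition tk0 (trace_matrix_idem hn he hTr)
  (F_mx_sq C hn hk) (@T_F_fixed_eq0 _ _ C n j)).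
split=> [[sumE capE]|[dec cap]].
  split=> [v|a b Ta Tb Tx TFx].
    have : cusp_forms k m (@Gamma0t Fq) (lincomb e v) by exact: lincomb_cusp.
    rewrite sumE => -[f /oldE [a [b [Ta Tb ->]]] [g gnew]].
    have [x gx] : exists x, g = lincomb e x by case: gnew => /(lincomb_surj he).
    rewrite gx in gnew *; rewrite -lincombD => /(lincomb_inj hn he) <-.
    by exists a, b, x; split=> //; exact/newE.
  have : [set 0] (lincomb e (a + F_mx C n j *m b)).
    by rewrite -capE; split; [apply/oldE; exists a, b|exact/newE].
  by move=> h; apply: (lincomb_inj hn he); rewrite lincomb0; exact: h.
split; apply/seteqP; split=> f.
- move=> /(lincomb_surj he) [v ->]; have [a [b [x [Ta Tb Tx ->]]]] := dec v.
  exists (lincomb e (a + F_mx C n j *m b)); first by apply/oldE; exists a, b.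
  by exists (lincomb e x); [exact/newE|rewrite [RHS]lincombD].
- move=> [f1 /oldE [a [b [_ _ ->]]] [f2 [h2 _ _] <-]].
  by apply: cusp_formsD => //; exact: lincomb_cusp.
- move=> [/oldE [a [b [Ta Tb ->]]] /newE [Tx TFx]] /=.
  by rewrite cap // lincomb0.
move=> -> /=; rewrite -(lincomb0 e); split; last first.
  by apply/newE; rewrite !mulmx0.
by apply/oldE; exists 0, 0; rewrite !mulmx0 addr0.
Qed.
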